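(* Let $X$ be a complete median space of finite rank and let $\Gamma$ act on $X$ by isometries without wall inversions. For every thick halfspace $\mathfrak h$, exactly one of the following happens: \begin{enumerate} \item $\mathfrak h$ is $\Gamma$-flippable; \item the closure of $\widetilde{\mathfrak h}^*$ in $\overline X$ contains a proper, nonempty, closed, convex, $\Gamma$-invariant subset $C\subseteq\overline X$. \end{enumerate}
   Context: A median space is a metric space $(X,d)$ in which for all $x,y,z$ the set $I(x,y)\cap I(y,z)\cap I(z,x)$ is a single point, where $I(x,y)=\{z:d(x,z)+d(z,y)=d(x,y)\}$; convex sets contain $I(x,y)$ whenever they contain $x,y$. A halfspace is a nonempty proper convex $\mathfrak h\subseteq X$ with convex complement $\mathfrak h^*$; $\mathscr H$ is the set of halfspaces; rank is the maximal size of a set of pairwise transverse halfspaces. $\mathfrak h$ is thick if $\mathfrak h$ and $\mathfrak h^*$ both have nonempty interior. With $d(A,B)=\inf d(a,b)$, an element $g$ flips $\mathfrak h$ if $d(g\mathfrak h^*,\mathfrak h^* )>0$ and $g\mathfrak h^*\neq\mathfrak h$; $\mathfrak h$ is $\Gamma$-flippable if some $g\in\Gamma$ flips it. The action is without wall inversions if $g\mathfrak h\neq\mathfrak h^*$ for all $g\in\Gamma$, $\mathfrak h\in\mathscr H$. Roller compactification: with $\sigma_x=\{\mathfrak h:x\in\mathfrak h\}$, $\mathscr H(x|y)=\sigma_y\setminus\sigma_x$ and ultrafilters the maximal sets of pairwise intersecting halfspaces, there is a canonical isometry-invariant measure $\widehat\nu$ on a $\sigma$-algebra $\widehat{\mathscr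 B}$ on $\mathscr H$ with $\widehat\nu(\mathscr H(x|y))=d(x,y)$; $\overline X$ is the set of ultrafilters $\sigma$ with $\sigma\triangle\sigma_x\in\widehat{\mathscr B}$ modulo null symmetric difference, with median $(\sigma_1\cap\sigma_2)\cup(\sigma_2\cap\sigma_3)\cup(\sigma_3\cap\sigma_1)$ and the coarsest topology making the projections $\overline X\to I(x,y)$ continuous; it is a compact median algebra containing $X$, on which $\Gamma$ acts. A subset $C\subseteq\overline X$ is convex if $m(a,b,c)\in C$ for $a,b\in C$, $c\in\overline X$. For $\mathfrak h\in\mathscr H$, $\widetilde{\mathfrak h}=\{\sigma\in\overline X:\mathfrak h\in\sigma\}$, a halfspace of $\overline X$ with $\widetilde{\mathfrak h}\cap X=\mathfrak h$, and $\widetilde{\mathfrak h}^*=\overline X\setminus\widetilde{\mathfrak h}$. *)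

(* Defs.v *)
From HB Require Import structures.
From mathcomp Require Import all_boot all_order all_algebra.
From mathcomp Require Import boolp classical_sets functions reals ereal
  topology normedtype sequences.

Set Implicit Arguments.
Unset Strict Implicit.
Unset Printing Implicit Defensive.
Import Order.TTheory GRing.Theory Num.Theory.
Local Open Scope classical_set_scope.
Local Open Scope ring_scope.

Definition symdiff {T : Type} (A B : set T) : set T := (A `\` B) `|` (B `\` A).

Definition sigma_alg_on {T : Type} (D : set T) (F : set (set T)) : Prop :=
  [/\ (forall A, F A -> A `<=` D), F set0,
      (forall A, F A -> F (D `\` A)) &
      (forall A : nat -> set T, (forall n, F (A n)) -> F (\bigcup_n A n))].

Definition gen_sigma {T : Type} (D : set T) (G : set (set T)) : set (set T) :=
  smallest (sigma_alg_on D) G.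

Definition is_measure_on {R : realType} {T : Type} (F : set (set T))
    (nu : set T -> \bar R) : Prop :=
  [/\ nu set0 = 0%E, (forall A, F A -> (0 <= nu A)%E) &
      (forall A : nat -> set T, (forall n, F (A n)) ->
         (forall i j, i <> j -> A i `&` A j = set0) ->
         nu (\bigcup_n A n) = (\sum_(i <oo) nu (A i))%E)].

Section Median.
Variables (R : realType) (X : Type) (d : X -> X -> R).

Definition is_metric : Prop :=
  [/\ (forall x y, 0 <= d x y), (forall x y, d x y = 0 <-> x = y),
      (forall x y, d x y = d y x) &
      (forall x y z, d x z <= d x y + d y z)].

Definition complete_metric : Prop :=
  forall u : nat -> X,
    (forall e, 0 < e -> exists N, forall m n, (N <= m)%N -> (N <= n)%N ->
        d (u m) (u n) < e) ->
    exists l, forall e, 0 < e -> exists N, forall n, (N <= n)%N -> d (u n) l < e.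

Definition interval (x y : X) : set X := [set z | d x z + d z y = d x y].

Definition median_space : Prop :=
  is_metric /\
  forall x y z, exists! m, [/\ interval x y m, interval y z m & interval z x m].

Definition convex (C : set X) : Prop :=
  forall x y, C x -> C y -> interval x y `<=` C.

Definition halfspace (h : set X) : Prop :=
  [/\ h !=set0, h <> setT, convex h & convex (~` h)].

Definition transverse (h k : set X) : Prop :=
  [/\ (h `&` k) !=set0, (h `&` ~` k) !=set0, (~` h `&` k) !=set0 &
      (~` h `&` ~` k) !=set0].

Definition finite_rank : Prop :=
  exists n : nat, forall (m : nat) (f : nat -> set X),
    (forall i, (i < m)%N -> halfspace (f i)) ->
    (forall i j, (i < m)%N -> (j < m)%N -> i <> j -> transverse (f i) (f j)) ->
    (m <= n)%N.

Definition open_ball (x : X) (r : R) : set X := [set y | d x y < r].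

Definition has_interior (A : set X) : Prop :=
  exists x r, 0 < r /\ open_ball x r `<=` A.

Definition thick (h : set X) : Prop :=
  [/\ halfspace h, has_interior h & has_interior (~` h)].

Definition set_dist (A B : set X) : R :=
  inf [set r | exists a b, [/\ A a, B b & r = d a b]].

Variables (G : Type) (mul : G -> G -> G) (one : G) (inv : G -> G)
  (act : G -> X -> X).

Definition is_group : Prop :=
  [/\ (forall a b c, mul a (mul b c) = mul (mul a b) c),
      (forall a, mul one a = a /\ mul a one = a) &
      (forall a, mul (inv a) a = one /\ mul a (inv a) = one)].

Definition isometric_action : Prop :=
  [/\ is_group, (forall x, act one x = x),
      (forall g k x, act (mul g k) x = act g (act k x)) &
      (forall g x y, d (act g x) (act g y) = d x y)].

Definition no_wall_inversions : Prop :=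
  forall g h, halfspace h -> act g @` h <> ~` h.

Definition flips (g : G) (h : set X) : Prop :=
  0 < set_dist (act g @` (~` h)) (~` h) /\ act g @` (~` h) <> h.

Definition flippable (h : set X) : Prop := exists g, flips g h.

Definition HS : set (set X) := [set h | halfspace h].

Definition sigma_pt (x : X) : set (set X) := [set h | halfspace h /\ h x].

Definition sep (x y : X) : set (set X) := sigma_pt y `\` sigma_pt x.

Definition pairwise_meeting (s : set (set X)) : Prop :=
  forall h k, s h -> s k -> (h `&` k) !=set0.

Definition ultrafilter (s : set (set X)) : Prop :=
  [/\ s `<=` HS, pairwise_meeting s &
      (forall t, s `<=` t -> t `<=` HS -> pairwise_meeting t -> t = s)].

Definition Bsig : set (set (set X)) :=
  gen_sigma HS [set E | exists x y, E = sep x y].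

Definition interval_measure (nu : set (set X) -> \bar R) : Prop :=
  is_measure_on Bsig nu /\ forall x y, nu (sep x y) = (d x y)%:E.

Definition Bhat : set (set (set X)) :=
  [set E | E `<=` HS /\ forall x y, Bsig (E `&` sep x y)].

Variable nu : set (set X) -> \bar R.

Definition hnull (E : set (set X)) : Prop :=
  Bhat E /\ forall x y, nu (E `&` sep x y) = 0%E.

(* representatives of points of \bar X *)
Definition admissible (s : set (set X)) : Prop :=
  ultrafilter s /\ exists x, Bhat (symdiff s (sigma_pt x)).

(* identification of points of \bar X *)
Definition xequiv (s t : set (set X)) : Prop := hnull (symdiff s t).

Definition medianU (a b c : set (set X)) : set (set X) :=
  (a `&` b) `|` (b `&` c) `|` (c `&` a).

Definition proj_rel (x y : X) (s : set (set X)) (z : X) : Prop :=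
  interval x y z /\ xequiv (sigma_pt z) (medianU (sigma_pt x) (sigma_pt y) s).

(* closure for the coarsest topology making all projections
   \bar X -> I(x,y) continuous (basic neighbourhoods: finitely many pairs) *)
Definition rclosure (A : set (set (set X))) (p : set (set X)) : Prop :=
  admissible p /\
  forall (n : nat) (pts : nat -> X * X) (e : R), 0 < e ->
    exists a, [/\ admissible a, A a &
      forall i, (i < n)%N ->
        exists z w, [/\ proj_rel (pts i).1 (pts i).2 a z,
                        proj_rel (pts i).1 (pts i).2 p w & d z w < e]].

(* subsets of \bar X = saturated sets of admissible ultrafilters *)
Definition xsubset (C : set (set (set X))) : Prop :=
  C `<=` admissible /\
  forall s t, admissible t -> xequiv s t -> C s -> C t.

Definition xclosed (C : set (set (set X))) : Prop := rclosure C `<=` C.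

Definition xconvex (C : set (set (set X))) : Prop :=
  forall a b c, C a -> C b -> admissible c -> C (medianU a b c).

Definition actU (g : G) (s : set (set X)) : set (set X) :=
  (fun h => act g @` h) @` s.

Definition xinvariant (C : set (set (set X))) : Prop :=
  forall g s, C s -> C (actU g s).

Definition htilde_star (h : set X) : set (set (set X)) :=
  [set s | admissible s /\ ~ s h].

Definition alternative2 (h : set X) : Prop :=
  exists C, [/\ xsubset C, C !=set0, (exists s, admissible s /\ ~ C s) &
     [/\ xclosed C, xconvex C, xinvariant C & C `<=` rclosure (htilde_star h)]].

End Median.

(* Main.v *)
From HB Require Import structures.
From mathcomp Require Import all_boot all_order all_algebra.
From mathcomp Require Import boolp classical_sets functions filter reals ereal
  topology normedtype sequences measure.
From mathcomp Require Import lra.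
Require Import Defs.

Set Implicit Arguments.
Unset Strict Implicit.
Unset Printing Implicit Defensive.
Import Order.TTheory GRing.Theory Num.Theory.
Local Open Scope classical_set_scope.
Local Open Scope ring_scope.

(** A point of the Roller compactification and a pair [x], [y] determine a point
    of the interval [I(x,y)] even without local compactness: the part of the
    ultrafilter inside [sep x y] is an upward closed measurable set of prime
    filters of the lattice [I(x,y)]; inner approximations of it and of its
    complement by sets stable under ultralimits are separated by a point of
    [I(x,y)], as in Priestley duality, and completeness of [X] gives the limit.

    If [g] flips [h], the closures of [h^*] and [g h^*] in [X] are disjoint, and
    the gates [p], [q] between them satisfy: every point in the closure of the
    star side of [h] (resp. [g h]) projects to [p] (resp. [q]) in [I(p,q)].  An
    invariant subset of the closure would thus give [p = q].

    If nothing flips [h], all the closures [K_g] of [g h^*] in [X] meet pairwise,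
    hence, by Helly's theorem, finitely many of them always meet.  The gates of a
    base point [x0] in the finite intersections form a net which is monotone with
    respect to [x0]; it converges to a point of the Roller compactification lying
    in all the closures of the [g h^*], and [C] is the intersection of these
    closures.  Monotonicity of the net replaces a compactness argument.  *)

(** * Sigma-algebras of subsets of a given set *)

Section SigmaAlgOn.
Variables (T : Type) (D : set T) (F : set (set T)).
Hypothesis HF : sigma_alg_on D F.

Lemma salg_sub A : F A -> A `<=` D. Proof. by case: HF => H _ _ _; exact: H. Qed.

Lemma salg0 : F set0. Proof. by case: HF. Qed.

Lemma salgC A : F A -> F (D `\` A). Proof. by case: HF => _ _ H _; exact: H. Qed.

Lemma salg_bigcup (A : nat -> set T) : (forall n, F (A n)) -> F (\bigcup_n A n).
Proof. by case: HF => _ _ _; apply. Qed.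

Lemma salgD0 : F D. Proof. by rewrite -(setD0 D); exact/salgC/salg0. Qed.

Lemma salgU A B : F A -> F B -> F (A `|` B).
Proof.
by move=> FA FB; rewrite -bigcup2E; apply: salg_bigcup => -[//|[//|n]]; exact: salg0.
Qed.

Lemma salgD A B : F A -> F B -> F (A `\` B).
Proof.
move=> FA FB.
have -> : A `\` B = D `\` ((D `\` A) `|` B).
  apply/seteqP; split=> t /=.
    by move=> [At nB]; split; [exact: (salg_sub FA)|case=> // -[]].
  move=> [Dt H]; split; last by move=> Bt; apply: H; right.
  by apply: contrapT => nA; apply: H; left.
by apply: salgC; apply: salgU => //; exact: salgC.
Qed.

Lemma salgI A B : F A -> F B -> F (A `&` B).
Proof. by move=> FA FB; rewrite -setDD; apply: salgD => //; exact: salgD. Qed.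

Lemma salg_bigcap (A : nat -> set T) : (forall n, F (A n)) -> F (\bigcap_n A n).
Proof.
move=> FA; have -> : \bigcap_n A n = D `\` \bigcup_n (D `\` A n).
  apply/seteqP; split=> t /=.
    move=> H; split; first exact: (salg_sub (FA 0%N) (H 0%N I)).
    by case=> n _ [_]; apply; exact: H.
  move=> [Dt H] n _; apply: contrapT => nA; apply: H.
  by exists n.
by apply: salgC; apply: salg_bigcup => n; exact: salgC.
Qed.

End SigmaAlgOn.

(** * Measures on such sigma-algebras, by transfer to bundled measures *)

Section MeasureOn.
Variables (R : realType) (T : pointedType) (D : set T) (F : set (set T)).
Variable nu : set T -> \bar R.
Hypotheses (HF : sigma_alg_on D F) (Hnu : is_measure_on F nu).

(* [nu] is only controlled on [F]; elsewhere the library measure is set to 0. *)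
Let G : set (set T) := [set E | F (E `&` D)].
Let mT := g_sigma_algebraType G.
Let mu : set mT -> \bar R :=
  fun E => if `[< F (E `&` D) >] then nu (E `&` D) else 0%E.

Let GE : @measurable _ mT = G.
Proof.
apply: sigma_algebra_id; split=> /=.
- by rewrite /G /= set0I; exact: (salg0 HF).
- move=> A GA; rewrite /G /= setTD setIC -setDE.
  have -> : D `\` A = D `\` (A `&` D).
    by apply/seteqP; split=> t /= [Dt H]; split=> // At; apply: H; tauto.
  exact: (salgC HF).
- by move=> A GA; rewrite /G /= setI_bigcupl; apply: (salg_bigcup HF).
Qed.

Let mu0 : mu set0 = 0%E.
Proof. by rewrite /mu set0I; case: ifP => // _; case: Hnu. Qed.

Let mu_ge0 E : (0 <= mu E)%E.
Proof. by rewrite /mu; case: asboolP => // FE; case: Hnu => _ H _; exact: H. Qed.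

Let muE E : F E -> mu E = nu E.
Proof.
move=> FE; rewrite /mu setIidl; last exact: (salg_sub HF).
by case: asboolP.
Qed.

Let mu_sadd : semi_sigma_additive mu.
Proof.
move=> A mA tA mUA; rewrite GE in mA mUA.
have muA i : mu (A i) = nu (A i `&` D).
  by rewrite /mu; case: asboolP => // -[]; exact: mA.
have -> : mu (\bigcup_n A n) = (\sum_(i <oo) mu (A i))%E.
  rewrite {1}/mu; case: asboolP => // _; rewrite setI_bigcupl.
  case: Hnu => _ _ -> //; first by apply: eq_eseriesr => i _; rewrite muA.
  move=> i j ij; rewrite setIACA; apply/seteqP; split=> // t [At _].
  by move/trivIsetP: tA => /(_ i j I I (introN eqP ij))/seteqP [+ _]; apply.
by apply: is_cvg_nneseries => n _ _; exact: mu_ge0.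
Qed.

HB.instance Definition _ := isMeasure.Build _ _ _ mu mu0 mu_ge0 mu_sadd.

Let mF E : F E -> measurable (E : set mT).
Proof. by move=> FE; rewrite GE /G /= setIidl //; exact: (salg_sub HF). Qed.

Lemma meas_ge0 A : F A -> (0 <= nu A)%E.
Proof. by case: Hnu => _ H _; exact: H. Qed.

Lemma meas0 : nu set0 = 0%E. Proof. by case: Hnu. Qed.

Lemma meas_DI A B : F A -> F B -> nu A = (nu (A `\` B) + nu (A `&` B))%E.
Proof.
move=> FA FB; rewrite -(muE FA) -(muE (salgD HF FA FB)) -(muE (salgI HF FA FB)).
by apply: measureDI; exact: mF.
Qed.

Lemma meas_le A B : F A -> F B -> A `<=` B -> (nu A <= nu B)%E.
Proof.
move=> FA FB AB; rewrite -(muE FA) -(muE FB).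
by apply: le_measure => //; rewrite inE; exact: mF.
Qed.

Lemma meas_U A B : F A -> F B -> (nu (A `|` B) <= nu A + nu B)%E.
Proof.
move=> FA FB; rewrite -(muE FA) -(muE FB) -(muE (salgU HF FA FB)).
by apply: measureU2; exact: mF.
Qed.

Lemma meas_le_U A B C : F A -> F B -> F C -> A `<=` B `|` C ->
  (nu A <= nu B + nu C)%E.
Proof.
move=> FA FB FC sub; apply: le_trans (meas_U FB FC).
by apply: meas_le => //; exact: (salgU HF).
Qed.

Lemma meas_sigma_sub E (A : nat -> set T) : F E -> (forall n, F (A n)) ->
  E `<=` \bigcup_n A n -> (nu E <= \sum_(n <oo) nu (A n))%E.
Proof.
move=> FE FA sub; rewrite -(muE FE).
rewrite -(eq_eseriesr (fun n _ => muE (FA n))).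
by apply: measure_sigma_subadditive => // [n|]; exact: mF.
Qed.

Lemma meas_nd (A : nat -> set T) : (forall n, F (A n)) -> nondecreasing_seq A ->
  nu (A n) @[n --> \oo] --> nu (\bigcup_n A n).
Proof.
move=> FA ndA; rewrite -(muE (salg_bigcup HF FA)).
have -> : (fun n => nu (A n)) = mu \o A by apply/funext => k /=; rewrite muE.
apply: (@nondecreasing_cvg_mu _ mT R mu) => //; first by move=> i; exact: mF.
by apply: mF; exact: (salg_bigcup HF).
Qed.

Lemma meas_ni (A : nat -> set T) : (nu (A 0%N) < +oo)%E -> (forall n, F (A n)) ->
  nonincreasing_seq A -> nu (A n) @[n --> \oo] --> nu (\bigcap_n A n).
Proof.
move=> A0 FA ndA; rewrite -(muE (FA 0%N)) in A0; rewrite -(muE (salg_bigcap HF FA)).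
have -> : (fun n => nu (A n)) = mu \o A by apply/funext => k /=; rewrite muE.
apply: (@nonincreasing_cvg_mu _ mT R mu) => //.
  by move=> i; exact: mF.
by apply: mF; exact: (salg_bigcap HF).
Qed.

End MeasureOn.

(** * Medians, halfspaces and gates *)

(** Made total by the default value [x], which is never taken in a median space. *)
Definition med (R : realType) (X : Type) (d : X -> X -> R) (x y z : X) : X :=
  if pselect (exists m, [/\ interval d x y m, interval d y z m & interval d z x m])
  is left H then projT1 (cid H) else x.

(** Closure for the metric of [X], to be kept apart from [rclosure] in the compactification. *)
Definition mcl (R : realType) (X : Type) (d : X -> X -> R) (D : set X) : set X :=
  [set x | forall e, 0 < e -> exists2 u, D u & d x u < e].

(* Halfspaces separate points and [h (med x y z)] is the majority of [h x], [h y],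
   [h z], so identities and inclusions between medians are checked one halfspace at
   a time, as propositional tautologies in the atoms [h x]. *)
Ltac hs_em h x := lazymatch goal with
  | _ : h x |- _ => fail
  | _ : ~ h x |- _ => fail
  | _ => destruct (pselect (h x))
  end.
Ltac hs_tauto h :=
  repeat match goal with
  | |- context [h ?x] => hs_em h x
  | _ : context [h ?x] |- _ => hs_em h x
  end; tauto.

Section MedianGeometry.
Variables (R : realType) (X : Type) (d : X -> X -> R).
Variable nu : set (set X) -> \bar R.
Hypotheses (ms : median_space d) (hnu : interval_measure d nu).
Local Notation hs := (halfspace d).
Local Notation m := (med d).
Local Notation I := (interval d).
Local Notation sep := (sep d).

Lemma d_ge0 x y : 0 <= d x y. Proof. by case: ms => -[]. Qed.
Lemma d_eq0 x y : d x y = 0 -> x = y. Proof. by case: ms => -[_ H _ _] _ /H. Qed.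
Lemma dxx x : d x x = 0. Proof. by case: ms => -[_ H _ _] _; apply/H. Qed.
Lemma dC x y : d x y = d y x. Proof. by case: ms => -[]. Qed.
Lemma dtri y x z : d x z <= d x y + d y z. Proof. by case: ms => -[]. Qed.

Lemma d_lt_eq x y : (forall e, 0 < e -> d x y < e) -> x = y.
Proof.
move=> H; apply: d_eq0; apply/eqP; rewrite eq_le d_ge0 andbT leNgt.
by apply/negP => /H; rewrite ltxx.
Qed.

Lemma medP x y z : [/\ I x y (m x y z), I y z (m x y z) & I z x (m x y z)].
Proof.
rewrite /med; case: pselect => [H|]; first by case: (cid H).
by have [w [Hw _]] := ms.2 x y z; case; exists w.
Qed.

Lemma hsC h : hs h -> hs (~` h).
Proof.
move=> [[a ha] hT ch cC]; split; rewrite ?setCK //.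
  by apply: contrapT => hN; apply: hT; apply/seteqP; split=> // x _;
    apply: contrapT => hx; apply: hN; exists x.
by move=> E; have: (~` h) a by rewrite E.
Qed.

Lemma hs_interval h x y z : hs h -> I x y z -> h x -> h y -> h z.
Proof. by move=> [_ _ c _] Iz hx hy; exact: c Iz. Qed.

(** The median lies in the three intervals between its arguments, so two arguments in [h] pull it
    into [h]; the same for the complement gives the converse. *)
Lemma hs_med h x y z : hs h ->
  h (m x y z) = ((h x /\ h y) \/ (h y /\ h z) \/ (h z /\ h x)).
Proof.
move=> hh; have [xy yz zx] := medP x y z.
have P k (hk : hs k) := hs_interval hk xy; have Q k (hk : hs k) := hs_interval hk yz.
have S k (hk : hs k) := hs_interval hk zx.
have := P h hh; have := Q h hh; have := S h hh.
have := P _ (hsC hh); have := Q _ (hsC hh); have := S _ (hsC hh).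
rewrite /setC /= => *; apply/propext.
hs_tauto h.
Qed.

Lemma sepE x y h : sep x y h <-> [/\ hs h, h y & ~ h x].
Proof.
split; first by move=> [[hh hy] n]; split=> // hx; apply: n.
by move=> [hh hy n]; split=> // -[].
Qed.

Lemma sepC x y h : sep x y h -> sep y x (~` h).
Proof.
by move=> /sepE[hh hy n]; apply/sepE; split=> //; exact: hsC.
Qed.

Lemma Bsig_salg : sigma_alg_on (HS d) (Bsig d).
Proof.
split.
- move=> A /(_ [set A | A `<=` HS d]); apply; split=> //; last first.
    by move=> _ [x [y ->]] h /sepE[].
  split=> //; first by move=> A' _ h [].
  by move=> F FA h [n _]; exact: FA.
- by move=> C [[]].
- by move=> A BA C HC; have := BA C HC; case: HC => [[_ _ H _] _]; exact: H.
- move=> A BA C HC; have H n := BA n C HC.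
  by case: HC => [[_ _ _ G] _]; exact: G.
Qed.

Lemma Bsig_sep x y : Bsig d (sep x y).
Proof. by move=> C [_]; apply; exists x, y. Qed.

Lemma nu_sep x y : nu (sep x y) = (d x y)%:E. Proof. by case: hnu. Qed.

Lemma nu_meas : is_measure_on (Bsig d) nu. Proof. by case: hnu. Qed.

(** The measure makes halfspaces separate points: under the hypothesis [sep y x] is empty, and its
    mass is [d y x]. *)
Lemma hs_ext x y : (forall h, hs h -> h x -> h y) -> x = y.
Proof.
move=> H; apply/esym/d_eq0; apply/EFin_inj; rewrite -nu_sep.
have -> : sep y x = set0.
  by apply/seteqP; split=> // h /sepE[hh hx]; apply; exact: H.
exact: (meas0 nu_meas).
Qed.

Lemma intervalP x y z : I x y z <-> (forall h, hs h -> h x -> h y -> h z).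
Proof.
split=> [Iz h hh|H]; first exact: hs_interval.
have <- : m x y z = z; last by case: (medP x y z).
apply: hs_ext => h hh; rewrite hs_med // => -[[]|]; [exact: H|tauto].
Qed.

Lemma med_id x y z : I x y z -> m x y z = z.
Proof.
move=> /intervalP H; apply: hs_ext => h hh; rewrite hs_med //.
by move=> -[[]|]; [exact: H|tauto].
Qed.

Lemma interval_l x y : I x y x. Proof. by apply/intervalP. Qed.
Lemma interval_r x y : I x y y. Proof. by apply/intervalP. Qed.

Lemma convex_med C x y z : convex d C -> C x -> C y -> C (m x y z).
Proof. by move=> cC Cx Cy; apply: cC Cx Cy _ _; case: (medP x y z). Qed.

(** Distances are masses of sets of separating halfspaces. Most metric estimates below come from
    this lemma or [d_sub2], checking one halfspace at a time. *)
Lemma d_sub x y u v : sep x y `<=` sep u v -> d x y <= d u v.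
Proof.
by move=> H; rewrite -lee_fin -!nu_sep; apply: (meas_le Bsig_salg nu_meas) => //;
  exact: Bsig_sep.
Qed.

Lemma d_sub2 x y u v u' v' : sep x y `<=` sep u v `|` sep u' v' ->
  d x y <= d u v + d u' v'.
Proof.
move=> H; rewrite -lee_fin EFinD -!nu_sep.
by apply: (meas_le_U Bsig_salg nu_meas) => //; exact: Bsig_sep.
Qed.

Lemma d_med_le x y z w : d (m x y z) (m x y w) <= d z w.
Proof.
apply: d_sub => h /sepE[hh]; rewrite !hs_med // => h1 h2.
by apply/sepE; split=> //; hs_tauto h.
Qed.

Lemma med_lip x y z x' y' z' :
  d (m x y z) (m x' y' z') <= d x x' + d y y' + d z z'.
Proof.
have rot a b c : m a b c = m b c a.
  by apply: hs_ext => h hh; rewrite !hs_med //; tauto.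
apply: le_trans (dtri (m x y z') _ _) _.
have := d_med_le x y z z'; have := dtri (m x y' z') (m x y z') (m x' y' z').
have := d_med_le z' x y y'; rewrite (rot z' x y) (rot z' x y').
have := d_med_le y' z' x x'; rewrite (rot y' z' x) (rot z' x y').
by rewrite (rot y' z' x') (rot z' x' y'); lra.
Qed.

Lemma mclW (D : set X) : D `<=` mcl d D.
Proof. by move=> x Dx e e0; exists x; rewrite ?dxx. Qed.

Lemma mclK (D : set X) : mcl d (mcl d D) `<=` mcl d D.
Proof.
move=> x H e e0; have e2 : 0 < e / 2 by lra.
have [u Du du] := H _ e2; have [v Dv dv] := Du _ e2.
by exists v => //; have := dtri u x v; lra.
Qed.

Lemma mcl_convex (D : set X) : convex d D -> convex d (mcl d D).
Proof.
move=> cD x y Dx Dy z Iz e e0; have e2 : 0 < e / 2 by lra.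
have [u Du du] := Dx _ e2; have [v Dv dv] := Dy _ e2.
exists (m u v z); first exact: convex_med.
rewrite -{1}(med_id Iz).
by have := med_lip x y z u v z; rewrite dxx; lra.
Qed.

Hypothesis cpl : complete_metric d.

(** Completeness in terms of approximate solutions: [S e] holds the solutions of accuracy [e], and a
    sequence chosen in the sets for [e = 1/(n+1)] is Cauchy. Gates, projections and joins are all
    obtained this way. *)
Lemma complete_limit (S : R -> set X) :
  (forall e, 0 < e -> S e !=set0) ->
  (forall e e', 0 < e -> e <= e' -> S e `<=` S e') ->
  (forall e a b, 0 < e -> S e a -> S e b -> d a b <= e) ->
  exists l, forall e, 0 < e -> forall a, S e a -> d a l <= e.
Proof.
move=> S0 Sm Sd.
have inv0 n : 0 < (n.+1%:R : R)^-1 by rewrite invr_gt0 ltr0n.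
have invle n k : (n <= k)%N -> (k.+1%:R : R)^-1 <= n.+1%:R^-1.
  by move=> nk; rewrite lef_pV2 ?posrE ?ltr0n // ler_nat ltnS.
have small (e : R) : 0 < e -> exists k : nat, k.+1%:R^-1 < e.
  by move=> /ltr_add_invr [k Hk]; exists k; rewrite add0r in Hk.
have [u Hu] := choice (fun n => S0 _ (inv0 n)).
have Hle N n : (N <= n)%N -> S N.+1%:R^-1 (u n).
  by move=> Nn; apply: Sm (Hu n) => //; exact: invle.
have [e e0|l Hl] := cpl (u := u).
  have [N HN] := small _ e0; exists N => i j Ni Nj.
  by apply: le_lt_trans HN; apply: Sd (Hle _ _ Ni) (Hle _ _ Nj).
exists l => e e0 a Sa; apply/ler_addgt0Pr => f f0.
have [N HN] := Hl _ f0; have [M HM] := small _ e0.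
have := HN (maxn N M) (leq_maxl _ _).
have H : S e (u (maxn N M)).
  apply: (Sm (M.+1%:R^-1)) => //; first exact: ltW.
  by apply: Hle; exact: leq_maxr.
have := Sd _ _ _ e0 Sa H; have := dtri (u (maxn N M)) a l; lra.
Qed.

Definition is_gate (D : set X) (x p : X) := D p /\ forall u, D u -> I x u p.

(** Nearly closest points of [D] to [x] are close to each other, so they converge to a closest point
    [p]. For [u] in [D], the median of [p], [u], [x] lies in [D] and between [p] and [x], hence is
    [p]. *)
Lemma gate_exists (D : set X) x : D !=set0 -> convex d D -> mcl d D `<=` D ->
  exists p, is_gate D x p.
Proof.
move=> [u0 Du0] cD clD; pose E := [set d x u | u in D].
have hE : has_inf E.
  by split; [exists (d x u0), u0|exists 0 => _ [u _ <-]; exact: d_ge0].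
have rle u : D u -> inf E <= d x u by move=> Du; apply: (ge_inf hE.2); exists u.
(* The median of [u], [v], [x] is in [D] and between [x] and [u], so [u] exceeds the infimum by at
   least its distance to that median. An excess of at most [e / 2] on both sides thus gives diameter
   [e]. *)
have dm u v : D u -> D v -> inf E + d (m u v x) u <= d x u.
  move=> Du Dv; have := rle _ (convex_med x cD Du Dv).
  by have [_ _] := medP u v x; rewrite /interval /=; lra.
have mC u v : m u v x = m v u x.
  by apply: hs_ext => h hh; rewrite !hs_med //; tauto.
have [|||p Hp] := @complete_limit (fun e => [set u | D u /\ d x u <= inf E + e / 2]).
- move=> e e0; have e2 : 0 < e / 2 by lra.
  by have [_ [u Du <-] lt] := inf_adherent e2 hE; exists u; split=> //; exact: ltW.
- by move=> e e' e0 ee' u [Du H]; split=> //; lra.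
- move=> e a b e0 [Da Ha] [Db Hb].
  have := dm _ _ Da Db; have := dm _ _ Db Da; rewrite (mC b a).
  by have := dtri (m a b x) a b; rewrite (dC a (m a b x)); lra.
have near e : 0 < e -> exists u, [/\ D u, d x u <= inf E + e / 2 & d u p <= e].
  move=> e0; have e2 : 0 < e / 2 by lra.
  have [_ [u Du <-] lt] := inf_adherent e2 hE; exists u; split=> //; first exact: ltW.
  by apply: Hp => //; split=> //; exact: ltW.
have Dp : D p.
  apply: clD => e e0; have e2 : 0 < e / 2 by lra.
  by have [u [Du _ H]] := near _ e2; exists u => //; rewrite dC; lra.
have dp : d x p = inf E.
  apply/eqP; rewrite eq_le (rle _ Dp) andbT; apply/ler_addgt0Pr => e e0.
  have e2 : 0 < e / 2 by lra.
  by have [u [Du H1 H2]] := near _ e2; have := dtri u x p; lra.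
exists p; split=> // u Du.
have E0 : m p u x = p.
  by apply: d_eq0; have := dm _ _ Dp Du; have := d_ge0 (m p u x) p; lra.
by rewrite -E0; apply/intervalP => h hh; rewrite hs_med //; tauto.
Qed.

Lemma gate_hs (D : set X) x p h : is_gate D x p -> hs h -> h p -> ~ h x -> D `<=` h.
Proof.
move=> [_ H] hh hp hx u Du; apply: contrapT => hu.
exact: (hs_interval (hsC hh) (H _ Du) hx hu).
Qed.

(** Let [q] be the gate in [E] of some [x] in [D], and [p] the gate of [q] in [D]. A halfspace with
    [q] and without [p] misses [D], hence misses [x], hence contains [E]: so [q] behaves as the gate
    of [p] too. *)
Lemma bigate (D E : set X) : D !=set0 -> convex d D -> mcl d D `<=` D ->
  E !=set0 -> convex d E -> mcl d E `<=` E ->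
  exists p q, [/\ D p, E q, (forall h, hs h -> h p -> ~ h q -> D `<=` h) &
                  (forall h, hs h -> h q -> ~ h p -> E `<=` h)].
Proof.
move=> [x Dx] cD clD E0 cE clE.
have [q gq] := gate_exists x E0 cE clE.
have [p gp] := gate_exists q (ex_intro _ x Dx) cD clD.
have H h : hs h -> h p -> ~ h q -> D `<=` h by move=> *; exact: gate_hs gp _ _ _.
exists p, q; split=> //; [exact: gp.1|exact: gq.1|].
move=> h hh hq hp; apply: (gate_hs gq) => //.
by apply: (H _ (hsC hh)) => //= /(_ hq).
Qed.

(** A halfspace separating the gates [p] and [q] separates all of [D] from all of [E], so [d p q] is
    a lower bound of the distances between them. *)
Lemma dist0_meet (D E : set X) : D !=set0 -> convex d D -> mcl d D `<=` D ->
  E !=set0 -> convex d E -> mcl d E `<=` E ->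
  (forall e, 0 < e -> exists u v, [/\ D u, E v & d u v < e]) -> (D `&` E) !=set0.
Proof.
move=> D0 cD clD E0 cE clE H.
have [p [q [Dp Eq HD HE]]] := bigate D0 cD clD E0 cE clE.
suff pq : p = q by exists p; split=> //; rewrite pq.
apply: d_lt_eq => e /H [u [v [Du Ev]]]; apply: le_lt_trans; apply: d_sub => h.
move=> /sepE[hh hq hp]; apply/sepE; split=> //; first exact: HE.
by apply: (HD _ (hsC hh)) => //= /(_ hq).
Qed.

(** Two extra sets are carried along, so that the induction hypothesis applies to each pair among
    [k], [l], [a]. Each of these three sets contains two of the points obtained, and the rest
    contains all three; their median is in every set. *)
Lemma helly (K : Type) (C : K -> set X) (F : seq K) :
  (forall k, convex d (C k)) -> (forall k l, (C k `&` C l) !=set0) ->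
  forall k l, (C k `&` C l `&` foldr (fun j D => C j `&` D) setT F) !=set0.
Proof.
move=> cC; elim: F => [|a F IH] H k l /=; first by rewrite setIT.
have cF : convex d (foldr (fun j D => C j `&` D) setT F).
  elim: F {IH} => [|b F IH] //= x y [Cx Fx] [Cy Fy] z Iz.
  by split; [exact: cC Iz|exact: IH Iz].
have [u [[uk ul] uF]] := IH H k l; have [v [[vk va] vF]] := IH H k a.
have [w [[wl wa] wF]] := IH H l a.
have rot x y z : m x y z = m y z x.
  by apply: hs_ext => h hh; rewrite !hs_med //; tauto.
exists (m u v w); split; [split|split].
- exact: convex_med.
- by rewrite -rot; exact: convex_med.
- by rewrite rot; exact: convex_med.
- exact: convex_med.
Qed.

End MedianGeometry.

(** * The measure on halfspaces and its ultrafilters *)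

Section IntervalMeasure.
Variables (R : realType) (X : Type) (d : X -> X -> R).
Hypothesis ms : median_space d.
Local Notation hs := (halfspace d).
Local Notation m := (med d).
Local Notation sep := (sep d).
Local Notation Bsig := (Bsig d).
Local Notation Bhat := (Bhat d).
Local Notation sg := (sigma_pt d).

(** By the majority rule, the right-hand side forces [x], [u] outside and [y], [v] inside. The
    separating sets thus form a pi-system. *)
Lemma sepI x y u v :
  sep x y `&` sep u v = sep (m x u (m y v x)) (m y v x).
Proof.
apply/seteqP; split=> h.
  move=> [/sepE[hh hy hx] /sepE[_ hv hu]].
  by apply/sepE; split=> //; rewrite !(hs_med ms) //; tauto.
move=> /sepE[hh]; rewrite !(hs_med ms) // => h1 h2.
by split; apply/sepE; split=> //; hs_tauto h.
Qed.

Lemma Bsig_ind (P : set (set X) -> Prop) :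
  lambda_system (HS d) [set E | P E] -> (forall x y, P (sep x y)) ->
  forall E, Bsig E -> P E.
Proof.
move=> lP Psep E BE; pose G := [set E | exists x y, E = sep x y].
have sub A : <<s HS d, G >> A -> A `<=` HS d.
  move=> sA; apply: (sA [set B | B `<=` HS d]); split=> /=; last first.
    by move=> _ [x [y ->]] h /sepE[].
  by split=> //; [move=> A' _ h []|move=> F FA h [n _]; exact: FA].
suff: <<s HS d, G >> `<=` [set E | P E].
  apply; apply: BE; split; last exact: sub_gen_smallest.
  by have [s0 sC sU] := smallest_sigma_algebra (HS d) G; split.
apply: lambda_system_subset => //; last by move=> _ [x [y ->]]; exact: Psep.
move=> _ _ [x [y ->]] [u [v ->]]; rewrite sepI.
by exists (m x u (m y v x)), (m y v x).
Qed.

(** Dynkin's argument on the pi-system of separating sets. Intersecting with [sep u v] keeps masses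
    finite, which the step for differences needs. *)
Lemma interval_measure_unique (nu nu' : set (set X) -> \bar R) :
  interval_measure d nu -> interval_measure d nu' ->
  forall E, Bsig E -> forall u v, nu (E `&` sep u v) = nu' (E `&` sep u v).
Proof.
move=> H H'; have S := Bsig_salg d.
have HSI u v : HS d `&` sep u v = sep u v by rewrite setIidr // => h /sepE[].
suff: forall E, Bsig E ->
    Bsig E /\ forall u v, nu (E `&` sep u v) = nu' (E `&` sep u v).
  by move=> K E /K[].
apply: Bsig_ind; last first.
  move=> x y; split; first exact: Bsig_sep.
  by move=> u v; rewrite sepI (nu_sep H) (nu_sep H').
split=> /=.
- by move=> A [/(salg_sub S)].
- by split; [exact: (salgD0 S)|move=> u v; rewrite HSI (nu_sep H) (nu_sep H')].
- move=> A B BA [mA EA] [mB EB]; split; first exact: (salgD S).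
  move=> u v; have mAs := salgI S mA (Bsig_sep u v).
  have mBs := salgI S mB (Bsig_sep u v).
  have := EA u v.
  rewrite (meas_DI S (nu_meas H) mAs mBs) (meas_DI S (nu_meas H') mAs mBs).
  have -> : (A `&` sep u v) `\` (B `&` sep u v) = (A `\` B) `&` sep u v.
    by apply/seteqP; split=> h /=; tauto.
  have -> : (A `&` sep u v) `&` (B `&` sep u v) = B `&` sep u v.
    by apply/seteqP; split=> h /=; have := BA h; tauto.
  rewrite (EB u v).
  have fin : nu' (B `&` sep u v) \is a fin_num.
    rewrite ge0_fin_numE; last exact: (meas_ge0 (nu_meas H')).
    apply: (@le_lt_trans _ _ (nu' (sep u v))); last by rewrite (nu_sep H') ltry.
    by apply: (meas_le S (nu_meas H')) => //; exact: Bsig_sep.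
  by move=> /(congr1 (fun z => z - nu' (B `&` sep u v))%E); rewrite !addeK.
- move=> F ndF EF; split; first by apply: (salg_bigcup S) => n; case: (EF n).
  move=> u v; rewrite setI_bigcupl.
  have mF n : Bsig (F n `&` sep u v).
    by apply: (salgI S); [case: (EF n)|exact: Bsig_sep].
  have nd : nondecreasing_seq (fun n => F n `&` sep u v).
    by move=> i j ij; apply/subsetPset; apply: setSI; apply/subsetPset; exact: ndF.
  have c1 := meas_nd S (nu_meas H) mF nd; have c2 := meas_nd S (nu_meas H') mF nd.
  have E12 : (fun n => nu (F n `&` sep u v)) = (fun n => nu' (F n `&` sep u v)).
    by apply/funext => n; case: (EF n) => _; apply.
  by move: c1; rewrite E12 => c1; apply: (cvg_unique _ c1 c2).
Qed.

(** * Invariance of the measure under maps of halfspaces *)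

Section Preimage.
Variable phi : set X -> set X.
Hypothesis phiHS : phi @^-1` (HS d) = HS d.
Hypothesis phisep : forall x y, exists x' y',
  phi @^-1` (sep x y) = sep x' y' /\ d x' y' = d x y.

Lemma Bsig_preimage E : Bsig E -> Bsig (phi @^-1` E).
Proof.
have S := Bsig_salg d.
move=> BE; apply: (BE [set E | E `<=` HS d /\ Bsig (phi @^-1` E)] _).2.
split=> [|_ [x [y ->]] /=]; last first.
  split; first by move=> h /sepE[].
  by have [x' [y' [-> _]]] := phisep x y; exact: Bsig_sep.
split=> /=.
- by move=> A [].
- by rewrite preimage_set0; split=> //; exact: (salg0 S).
- move=> A [_ BA]; split; first by move=> h [].
  rewrite (_ : _ @^-1` _ = HS d `\` phi @^-1` A); first exact: (salgC S).
  by rewrite -{2}phiHS.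
- move=> A BA; split; first by move=> h [n _]; case: (BA n) => H _; exact: H.
  by rewrite preimage_bigcup; apply: (salg_bigcup S) => n; case: (BA n).
Qed.

(** The image of [nu] under [phi] is again an interval measure, so uniqueness applies. The lemma
    serves for complementation and for isometries. *)
Lemma nu_preimage nu E : interval_measure d nu -> Bsig E ->
  forall u v, nu (phi @^-1` (E `&` sep u v)) = nu (E `&` sep u v).
Proof.
move=> H BE u v.
have H' : interval_measure d (fun E => nu (phi @^-1` E)).
  split; last first.
    by move=> x y; have [x' [y' [-> <-]]] := phisep x y; exact: nu_sep.
  case: (nu_meas H) => n0 nge nU; split; first by rewrite preimage_set0.
    by move=> A BA; apply: nge; exact: Bsig_preimage.
  move=> A BA dA; rewrite preimage_bigcup nU //.
    by move=> n; exact: Bsig_preimage.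
  by move=> i j ij; rewrite -preimage_setI dA // preimage_set0.
exact: (interval_measure_unique H' H).
Qed.

End Preimage.

Lemma setC_HS : setC @^-1` (HS d) = HS d.
Proof.
apply/seteqP; split=> h /=; last exact: hsC.
by move=> hh; have := hsC hh; rewrite setCK.
Qed.

Lemma setC_sep x y : setC @^-1` (sep x y) = sep y x.
Proof.
apply/seteqP; split=> h /=; last exact: sepC.
by move=> hh; have := sepC hh; rewrite setCK.
Qed.

(** * Measurable sets of halfspaces and ultrafilters *)

Lemma BhatU A B : Bhat A -> Bhat B -> Bhat (A `|` B).
Proof.
move=> [A1 A2] [B1 B2]; split; first by move=> h [/A1|/B1].
by move=> x y; rewrite setIUl; exact: (salgU (Bsig_salg d)).
Qed.

Lemma BhatI A B : Bhat A -> Bhat B -> Bhat (A `&` B).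
Proof.
move=> [A1 A2] [B1 B2]; split; first by move=> h [/A1].
move=> x y; rewrite -(setIid (sep x y)) setIACA.
exact: (salgI (Bsig_salg d)).
Qed.

Lemma BhatD A B : Bhat A -> Bhat B -> Bhat (A `\` B).
Proof.
move=> [A1 A2] [B1 B2]; split; first by move=> h [/A1].
move=> x y; rewrite (_ : _ `&` _ = (A `&` sep x y) `\` (B `&` sep x y)).
  exact: (salgD (Bsig_salg d)).
by apply/seteqP; split=> h /=; tauto.
Qed.

Lemma Bhat_symdiff A B : Bhat A -> Bhat B -> Bhat (symdiff A B).
Proof. by move=> *; apply: BhatU; exact: BhatD. Qed.

Lemma Bhat_pt x : Bhat (sg x).
Proof.
split; first by move=> h [].
move=> u v; rewrite (_ : _ `&` _ = sep u v `&` sep u x); last first.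
  apply/seteqP; split=> h.
    by move=> [[hh hx] /sepE[_ hv hu]]; split; apply/sepE.
  by move=> [s /sepE[hh hx _]].
by apply: (salgI (Bsig_salg d)); exact: Bsig_sep.
Qed.

Lemma Bhat_medianU a b c : Bhat a -> Bhat b -> Bhat c -> Bhat (medianU a b c).
Proof. by move=> *; apply: BhatU; [apply: BhatU|]; exact: BhatI. Qed.

(** If a maximal family contained neither [h] nor its complement, it would have a member disjoint
    from each of them, and these two members could not meet. *)
Lemma ultraP s : ultrafilter d s <->
  [/\ s `<=` HS d, pairwise_meeting s & forall h, hs h -> s h \/ s (~` h)].
Proof.
split=> [[sH sm smax]|[sH sm sc]].
  split=> // h hh; apply: contrapT => /not_orP[nh nC].
  have ext k : hs k -> ~ s k -> exists2 a, s a & a `<=` ~` k.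
    move=> hk nk; apply: contrapT => N; apply: nk.
    have N' a : s a -> (a `&` k) !=set0.
      move=> sa; apply: contrapT => E; apply: N; exists a => // x ax kx.
      by apply: E; exists x.
    have <- : s `|` [set k] = s.
      apply: smax; first by move=> x; left.
        by move=> x [/sH//|->].
      move=> x y [sx|->] [sy|->]; [exact: sm|exact: N'|by rewrite setIC; exact: N'|].
      by rewrite setIid; case: hk.
    by right.
  have [a sa ah] := ext _ hh nh; have [b sb bh] := ext _ (hsC hh) nC.
  have [x [ax bx]] := sm _ _ sa sb.
  by apply: (bh x bx); exact: ah.
split=> // t st tH tm; apply/seteqP; split=> // h th.
have [//|/st tC] := sc h (tH _ th).
by have [x []] := tm _ _ th tC.
Qed.

Lemma ultraN s h : ultrafilter d s -> hs h -> s (~` h) <-> ~ s h.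
Proof.
move=> /ultraP[sH sm sc] hh; split=> [sC sh|].
  by have [x []] := sm _ _ sh sC.
by case: (sc h hh).
Qed.

Lemma ultra_up s h k : ultrafilter d s -> s h -> hs k -> h `<=` k -> s k.
Proof.
move=> us sh hk hsub; apply: contrapT => nk.
have sC : s (~` k) by apply/ultraN.
have /ultraP[_ sm _] := us; have [x [hx]] := sm _ _ sh sC; apply; exact: hsub.
Qed.

Lemma ultra_pt x : ultrafilter d (sg x).
Proof.
apply/ultraP; split; first by move=> h [].
  by move=> h k [hh hx] [hk kx]; exists x.
by move=> h hh; case: (pselect (h x)) => hx; [left|right; split=> //; exact: hsC].
Qed.

Lemma ultra_medianU a b c : ultrafilter d a -> ultrafilter d b ->
  ultrafilter d c -> ultrafilter d (medianU a b c).
Proof.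
move=> ua ub uc; apply/ultraP.
have /ultraP[aH am aC] := ua; have /ultraP[bH bm bC] := ub.
have /ultraP[cH cm cC] := uc; split.
- by move=> h [[[/aH]|[/bH]]|[/cH]].
- move=> h k; rewrite /medianU /= => H K.
  (* Two majorities among three ultrafilters share one of them. *)
  have [[ah ak]|[[bh bk]|[ch ck]]] : (a h /\ a k) \/ (b h /\ b k) \/ (c h /\ c k).
    by tauto.
  + exact: am.
  + exact: bm.
  + exact: cm.
- move=> h hh; rewrite /medianU /=.
  by have := aC h hh; have := bC h hh; have := cC h hh; tauto.
Qed.

Lemma adm_ultra s : admissible d s -> ultrafilter d s. Proof. by case. Qed.

Lemma adm_Bhat s : admissible d s -> Bhat s.
Proof.
move=> [us [x Bx]]; rewrite (_ : s = symdiff (symdiff s (sg x)) (sg x)).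
  by apply: Bhat_symdiff => //; exact: Bhat_pt.
apply/seteqP; split=> h; rewrite /symdiff /=; last first.
  by case: (pselect (s h)); tauto.
by case: (pselect (sg x h)); tauto.
Qed.

Lemma adm_intro (x : X) s : ultrafilter d s -> Bhat s -> admissible d s.
Proof.
by move=> us Bs; split=> //; exists x; apply: Bhat_symdiff => //; exact: Bhat_pt.
Qed.

Lemma adm_pt x : admissible d (sg x).
Proof. by apply: (adm_intro x); [exact: ultra_pt|exact: Bhat_pt]. Qed.

Lemma adm_medianU a b c : admissible d a -> admissible d b -> admissible d c ->
  admissible d (medianU a b c).
Proof.
move=> ha hb hc; have [_ [x _]] := ha; apply: (adm_intro x).
  by apply: ultra_medianU; exact: adm_ultra.
by apply: Bhat_medianU; exact: adm_Bhat.
Qed.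

Lemma sigma_med x y z : sg (m x y z) = medianU (sg x) (sg y) (sg z).
Proof.
apply/seteqP; split=> h.
  by move=> [hh]; rewrite (hs_med ms) // /medianU /sigma_pt /=; tauto.
rewrite /medianU /sigma_pt /= => H; have hh : hs h by tauto.
by split=> //; rewrite (hs_med ms) //; tauto.
Qed.

(** * Null sets, identification of points and uniqueness of projections *)

Variable nu : set (set X) -> \bar R.
Hypothesis hnu : interval_measure d nu.
Local Notation hnull := (hnull d nu).
Local Notation xequiv := (xequiv d nu).
Local Notation proj := (proj_rel d nu).

Lemma hnull_sub A B : hnull B -> Bhat A -> A `<=` B -> hnull A.
Proof.
move=> [BB nB] BA AB; split=> // x y; apply/eqP; rewrite eq_le.
rewrite (meas_ge0 (nu_meas hnu)) ?andbT; last by case: BA.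
rewrite -(nB x y); apply: (meas_le (Bsig_salg d) (nu_meas hnu)).
- by case: BA.
- by case: BB.
- exact: setSI.
Qed.

Lemma hnullU A B : hnull A -> hnull B -> hnull (A `|` B).
Proof.
move=> [BA nA] [BB nB]; have BU := BhatU BA BB; split=> // x y.
apply/eqP; rewrite eq_le (meas_ge0 (nu_meas hnu)) ?andbT; last by case: BU.
rewrite -[leRHS]adde0 -{1}(nA x y) -(nB x y) setIUl.
apply: (meas_U (Bsig_salg d) (nu_meas hnu)); first by case: BA.
by case: BB.
Qed.

Lemma hnull0 : hnull set0.
Proof.
split; last by move=> x y; rewrite set0I; exact: (meas0 (nu_meas hnu)).
by split=> // x y; rewrite set0I; exact: (salg0 (Bsig_salg d)).
Qed.

Lemma xequiv_refl s : xequiv s s.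
Proof. by rewrite /Defs.xequiv /symdiff setDv setU0; exact: hnull0. Qed.

Lemma xequiv_sym s t : xequiv s t -> xequiv t s.
Proof. by rewrite /Defs.xequiv /symdiff setUC. Qed.

Lemma xequiv_trans s t r : Bhat s -> Bhat r -> xequiv s t -> xequiv t r ->
  xequiv s r.
Proof.
move=> Bs Br st tr; apply: hnull_sub (hnullU st tr) _ _; first exact: Bhat_symdiff.
move=> h; rewrite /symdiff /=; case: (pselect (t h)); tauto.
Qed.

Lemma xequiv_medianU a b c a' b' c' :
  Bhat a -> Bhat b -> Bhat c -> Bhat a' -> Bhat b' -> Bhat c' ->
  xequiv a a' -> xequiv b b' -> xequiv c c' ->
  xequiv (medianU a b c) (medianU a' b' c').
Proof.
move=> *; apply: (@hnull_sub _ ((symdiff a a' `|` symdiff b b') `|` symdiff c c')).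
- by apply: hnullU => //; exact: hnullU.
- by apply: Bhat_symdiff; exact: Bhat_medianU.
- move=> h; rewrite /symdiff /medianU /=.
  by case: (pselect (a h)); case: (pselect (b h)); case: (pselect (c h));
    case: (pselect (a' h)); case: (pselect (b' h)); case: (pselect (c' h)); tauto.
Qed.

Lemma xequiv_pt x y : xequiv (sg x) (sg y) -> x = y.
Proof.
move=> [_ /(_ x y)]; rewrite (_ : _ `&` _ = sep x y) ?(nu_sep hnu).
  by move=> [dxy0]; exact: (d_eq0 ms).
apply/seteqP; split=> h; first by case.
by move=> s; split=> //; right.
Qed.

Lemma proj_unique x y s z w : admissible d s -> proj x y s z -> proj x y s w ->
  z = w.
Proof.
move=> as_ [_ pz] [_ pw]; apply: xequiv_pt.
by apply: xequiv_trans pz (xequiv_sym pw); exact: Bhat_pt.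
Qed.

Lemma Bhat_projU x y s : admissible d s -> Bhat (medianU (sg x) (sg y) s).
Proof.
by move=> /adm_Bhat Bs; apply: Bhat_medianU => //; exact: Bhat_pt.
Qed.

Lemma proj_xequiv x y s t z : admissible d s -> admissible d t -> xequiv s t ->
  proj x y s z -> proj x y t z.
Proof.
move=> as_ at_ st [Iz pz]; split=> //.
apply: xequiv_trans pz _; [exact: Bhat_pt|exact: Bhat_projU|].
by apply: xequiv_medianU (xequiv_refl _) (xequiv_refl _) st;
  (exact: Bhat_pt || exact: adm_Bhat).
Qed.

Lemma proj_exact x y s z : interval d x y z ->
  sg z = medianU (sg x) (sg y) s -> proj x y s z.
Proof. by move=> Iz E; split=> //; rewrite E; exact: xequiv_refl. Qed.

Lemma proj_pt x y w : proj x y (sg w) (m x y w).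
Proof. by apply: proj_exact; [case: (medP ms x y w)|exact: sigma_med]. Qed.

Lemma proj_medianU x y a b c z1 z2 z3 :
  admissible d a -> admissible d b -> admissible d c ->
  proj x y a z1 -> proj x y b z2 -> proj x y c z3 ->
  proj x y (medianU a b c) (m z1 z2 z3).
Proof.
move=> ha hb hc [I1 p1] [I2 p2] [I3 p3]; split.
  apply/(intervalP ms hnu) => h hh hx hy.
  have H z : interval d x y z -> h z by move=> /(hs_interval hh); apply.
  by rewrite (hs_med ms) //; have := H _ I1; have := H _ I2; tauto.
rewrite sigma_med.
have -> : medianU (sg x) (sg y) (medianU a b c) =
    medianU (medianU (sg x) (sg y) a) (medianU (sg x) (sg y) b)
            (medianU (sg x) (sg y) c).
  by apply/seteqP; split=> h; rewrite /medianU /=; tauto.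
by apply: xequiv_medianU => //; (exact: Bhat_pt || exact: Bhat_projU).
Qed.

End IntervalMeasure.

(** * Projections to intervals *)

Definition ulim {X : Type} (U : set_system (set X)) : set X :=
  [set u | U [set k | k u]].

(** Closedness in the product topology on subsets of [X], where [ulim U] is the limit of [U].
    Compactness enters through the existence of ultrafilters. *)
Definition uclosed {X : Type} (K : set (set X)) : Prop :=
  forall U, UltraFilter U -> U K -> K (ulim U).

Section Ultralimits.
Variables (R : realType) (X : Type) (d : X -> X -> R).
Local Notation hs := (halfspace d).
Local Notation sep := (sep d).

Lemma ulimN (U : set_system (set X)) u : UltraFilter U ->
  ~ ulim U u -> U [set k | ~ k u].
Proof. by move=> UU nu; have [] := in_ultra_setVsetC [set k | k u] UU. Qed.

Lemma ulim_ex (U : set_system (set X)) E F : UltraFilter U -> U E -> U F ->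
  exists k, E k /\ F k.
Proof. by move=> UU UE UF; exact: (filter_ex (filterI UE UF)). Qed.

(** Fixing [y] inside and [x] outside keeps the limit nonempty and proper; convexity of both sides
    concerns three points at a time and passes to the limit. *)
Lemma uclosed_sep x y : uclosed (sep x y).
Proof.
move=> U UU Us; have sE k : sep x y k -> [/\ hs k, k y & ~ k x] by move=> /sepE.
have uy : ulim U y by apply: filterS Us => k /sE[].
have ux : ~ ulim U x.
  by move=> Hx; have [k [/sE[_ _ nx] kx]] := ulim_ex UU Us Hx; exact: nx kx.
apply/sepE; split=> //; split; first by exists y.
- by move=> E; apply: ux; rewrite E.
- move=> a b Ua Ub z Iz; apply: filterS (filterI Us (filterI Ua Ub)).
  by move=> k [/sE[hk _ _] [ka kb]]; exact: hs_interval hk Iz ka kb.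
- move=> a b /(ulimN UU) Ua /(ulimN UU) Ub z Iz Uz.
  have [k [[/sE[hk _ _] [ka kb]] kz]] := ulim_ex UU (filterI Us (filterI Ua Ub)) Uz.
  exact: (hs_interval (hsC hk) Iz ka kb).
Qed.

Lemma uclosed_sepD x y a b : uclosed (sep x y `\` sep a b).
Proof.
move=> U UU Us; split.
  by apply: uclosed_sep; apply: filterS Us => k [].
move=> /sepE[_ Ub /(ulimN UU) Ua].
have [k [[/sepE[hk _ _] nk] [kb ka]]] := ulim_ex UU Us (filterI Ub Ua).
by apply: nk; apply/sepE.
Qed.

Lemma uclosedI (K L : set (set X)) : uclosed K -> uclosed L -> uclosed (K `&` L).
Proof.
move=> cK cL U UU UKL; split; [apply: cK|apply: cL] => //;
  by apply: filterS UKL => k [].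
Qed.

Lemma uclosed0 : uclosed (@set0 (set X)).
Proof. by move=> U UU U0; have [] := filter_ex U0. Qed.

Lemma uclosedU (K L : set (set X)) : uclosed K -> uclosed L -> uclosed (K `|` L).
Proof.
move=> cK cL U UU UKL; have [UK|UK] := in_ultra_setVsetC K UU.
  by left; exact: cK.
by right; apply: cL => //; apply: filterS (filterI UKL UK) => k [[]].
Qed.

Lemma uclosed_bigsetU (K : nat -> set (set X)) n : (forall i, uclosed (K i)) ->
  uclosed (\big[setU/set0]_(i < n) K i).
Proof. by move=> cK; elim/big_ind: _ => //; [exact: uclosed0|exact: uclosedU]. Qed.

Lemma uclosed_bigcap (K : nat -> set (set X)) : (forall i, uclosed (K i)) ->
  uclosed (\bigcap_i K i).
Proof.
by move=> cK U UU UK i _; apply: cK; apply: filterS UK => k H; exact: H.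
Qed.

End Ultralimits.

(** * Inner regularity and approximate projections *)

Section Projections.
Variables (R : realType) (X : Type) (d : X -> X -> R).
Variable nu : set (set X) -> \bar R.
Hypotheses (ms : median_space d) (hnu : interval_measure d nu).
Local Notation hs := (halfspace d).
Local Notation m := (med d).
Local Notation I := (interval d).
Local Notation sep := (sep d).
Local Notation Bsig := (Bsig d).
Local Notation Bhat := (Bhat d).
Let S := Bsig_salg d.
Let mo := nu_meas hnu.

(** Inner approximation of [E] and of its complement at once, which makes the class stable under
    complements. *)
Definition regular_in x y (E : set (set X)) : Prop :=
  forall e, 0 < e -> exists K L,
    [/\ uclosed K /\ uclosed L, Bsig K /\ Bsig L, K `<=` sep x y `&` E,
        L `<=` sep x y `\` E & (nu (sep x y `\` (K `|` L)) <= e%:E)%E].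

Lemma Bsig_regular x y E : Bsig E -> regular_in x y E.
Proof.
move=> BE; apply: (BE [set E | E `<=` HS d /\ regular_in x y E] _).2.
have sH : sep x y `<=` HS d by move=> h /sepE[].
have exact_split e K L : 0 < e -> sep x y `<=` K `|` L ->
    (nu (sep x y `\` (K `|` L)) <= e%:E)%E.
  move=> e0 H; rewrite (_ : _ `\` _ = set0) ?(meas0 mo) ?lee_fin ?(ltW e0) //.
  by apply/seteqP; split=> // k [/H].
split=> [|_ [a [b ->]]]; last first.
  split; first by move=> h /sepE[].
  move=> e e0; exists (sep x y `&` sep a b), (sep x y `\` sep a b).
  have Bxy : Bsig (sep x y) by exact: Bsig_sep.
  have Bab : Bsig (sep a b) by exact: Bsig_sep.
  split=> //.
  - split; last exact: uclosed_sepD.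
    by apply: uclosedI; exact: uclosed_sep.
  - by split; [exact: (salgI S Bxy Bab)|exact: (salgD S Bxy Bab)].
  - by apply: exact_split => // k xyk; case: (pselect (sep a b k)); [left|right].
split=> /=.
- by move=> A [].
- split=> // e e0; exists set0, (sep x y); split=> //.
  + by split; [exact: uclosed0|exact: uclosed_sep].
  + by split; [exact: (salg0 S)|exact: Bsig_sep].
  + by rewrite setD0.
  + by apply: exact_split => // k; right.
- move=> A [AH rA]; split; first by move=> h [].
  move=> e /rA[K [L [[cK cL] [BK BL] KA LA err]]]; exists L, K; split=> //.
  + by move=> k /LA[kxy nk]; split=> //; split=> //; exact: sH.
  + by move=> k /KA[kxy Ak]; split=> // -[].
  + by rewrite setUC.
- move=> A HA; split; first by move=> h [n _ An]; exact: (HA n).1.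
  move=> e e0; have e20 : 0 < e / 2 by lra.
  (* The errors add up to [e / 2], leaving [e / 2] for truncating the union. *)
  pose err n : R := e / 2 / (2 ^ n.+1)%:R.
  have err0 n : 0 < err n by rewrite /err divr_gt0 // ltr0n expn_gt0.
  pose good n (p : set (set X) * set (set X)) :=
    [/\ uclosed p.1 /\ uclosed p.2, Bsig p.1 /\ Bsig p.2,
        p.1 `<=` sep x y `&` A n, p.2 `<=` sep x y `\` A n &
        (nu (sep x y `\` (p.1 `|` p.2)) <= (err n)%:E)%E].
  have /choice[p Hp] : forall n, exists p, good n p.
    move=> n; have [K [L H]] := (HA n).2 _ (err0 n); by exists (K, L).
  pose K n := (p n).1; pose L := \bigcap_n (p n).2.
  pose KU n := \big[setU/set0]_(i < n) K i.
  have cK n : uclosed (K n) by case: (Hp n) => -[].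
  have BK n : Bsig (K n) by case: (Hp n) => _ [].
  have BKU n : Bsig (KU n).
    by rewrite /KU; elim/big_ind: _ => //; [exact: (salg0 S)|exact: (salgU S)].
  have BL : Bsig L by apply: (salg_bigcap S) => n; case: (Hp n) => _ [].
  have Bxy : Bsig (sep x y) by exact: Bsig_sep.
  (* Closedness survives arbitrary intersections but only finite unions, so the union of the [K n]
     is truncated at [n]. The errors [B n] decrease to a set of mass at most [e / 2], and continuity
     from above gives an index with error below [e]. *)
  pose B n := sep x y `\` (KU n `|` L).
  have BB n : Bsig (B n) by apply: (salgD S) => //; exact: (salgU S).
  have KUE n : KU n = \bigcup_(i in `I_n) K i by rewrite bigcup_mkord.
  have niB : nonincreasing_seq B.
    move=> i j ij; apply/subsetPset; apply: setDS; apply: setSU; rewrite !KUE.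
    by move=> k [l /= li Kl]; exists l => //=; exact: leq_trans ij.
  have capB : (nu (\bigcap_n B n) <= (e / 2)%:E)%E.
    have BD n : Bsig (sep x y `\` ((p n).1 `|` (p n).2)).
      by case: (Hp n) => _ [? ?] _ _ _; apply: (salgD S) => //; exact: (salgU S).
    apply: (@le_trans _ _ (\sum_(n <oo) nu (sep x y `\` ((p n).1 `|` (p n).2)))%E).
      apply: (meas_sigma_sub S mo) => //; first exact: (salg_bigcap S).
      move=> k Hk; have [kxy nk] := Hk 0%N Logic.I.
      apply: contrapT => N; apply: nk; right=> n _; apply: contrapT => nkn.
      apply: N; exists n => //; split=> // -[Kk|//].
      have [_ H] := Hk n.+1 Logic.I; apply: H; left; rewrite KUE.
      by exists n => //=.
    apply: le_trans (epsilon_trick0 xpredT (ltW e20)).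
    apply: lee_nneseries => n _; first by move=> _; exact: (meas_ge0 mo).
    by case: (Hp n).
  have Boo : (nu (B 0%N) < +oo)%E.
    apply: (@le_lt_trans _ _ (nu (sep x y))); last by rewrite (nu_sep hnu) ltry.
    by apply: (meas_le S mo) => // k [].
  have lte : (nu (\bigcap_n B n) < e%:E)%E.
    by apply: le_lt_trans capB _; rewrite lte_fin; lra.
  have := meas_ni S mo Boo BB niB.
  move=> /(_ _ (open_nbhs_nbhs (conj (@open_ereal_lt_ereal _ e%:E) lte))).
  move=> [N _ /(_ N (leqnn N)) /= HN].
  exists (KU N), L; split=> //; last exact: ltW.
  + split; first exact: uclosed_bigsetU.
    by apply: uclosed_bigcap => n; case: (Hp n) => -[].
  + rewrite KUE => k [i _ Kk]; case: (Hp i) => _ _ /(_ _ Kk)[kxy Aik] _ _.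
    by split=> //; exists i.
  + move=> k Lk; split; first by case: (Hp 0%N) => _ _ _ /(_ _ (Lk 0%N Logic.I))[].
    by move=> [n _ Ak]; case: (Hp n) => _ _ _ /(_ _ (Lk n Logic.I))[].
Qed.

(* Priestley separation: otherwise an ultralimit produces [k] in [K] and [l] in
   [L] with [k] contained in [l], against upward closure of [s]. *)
Lemma separating_point x y s (K L : set (set X)) : ultrafilter d s ->
  uclosed K -> uclosed L -> K `<=` sep x y `&` s -> L `<=` sep x y `\` s ->
  exists z, [/\ I x y z, forall k, K k -> k z & forall k, L k -> ~ k z].
Proof.
move=> us cK cL Ks Ls; apply: contrapT => N.
pose Phi z := I x y z /\ forall k, K k -> k z.
pose J z := I x y z /\ forall k, L k -> ~ k z.
have hsI h z : hs h -> I x y z -> h x -> h y -> h z.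
  by move=> hh Iz; exact: hs_interval hh Iz.
have IP z : (forall h, hs h -> h x -> h y -> h z) -> I x y z.
  by move=> H; apply/(intervalP ms hnu).
have sE k : sep x y k -> [/\ hs k, k y & ~ k x] by move=> /sepE.
have KE k : K k -> [/\ hs k, k y & ~ k x] by move=> /Ks[/sE].
have LE k : L k -> [/\ hs k, k y & ~ k x] by move=> /Ls[/sE].
have Phiy : Phi y by split=> [|k /KE[]//]; exact: (interval_r ms hnu).
have Jx : J x by split=> [|k /LE[]//]; exact: (interval_l ms hnu).
pose D := [set p : X * X | Phi p.1 /\ J p.2].
pose B (p : X * X) := [set k | [/\ sep x y k, k p.1 & ~ k p.2]].
have FB : ProperFilter (filter_from D B).
  apply: filter_from_proper.
    apply: filter_from_filter; first by exists (y, x).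
    move=> [z w] [z' w'] [/= [Iz Kz] [Iw Lw]] [/= [Iz' Kz'] [Iw' Lw']].
    exists (m x z z', m y w w'); rewrite /D /B /=.
      split; split.
      - apply: IP => h hh hx hy; rewrite (hs_med ms) //.
        by have := hsI _ _ hh Iz hx hy; tauto.
      - move=> k Kk; have [hk _ _] := KE _ Kk; rewrite (hs_med ms) //.
        by have := Kz _ Kk; have := Kz' _ Kk; tauto.
      - apply: IP => h hh hx hy; rewrite (hs_med ms) //.
        by have := hsI _ _ hh Iw hx hy; tauto.
      - move=> k Lk; have [hk _ _] := LE _ Lk; rewrite (hs_med ms) //.
        by have := Lw _ Lk; have := Lw' _ Lk; tauto.
    move=> k /= [kxy]; have [hk ky kx] := sE _ kxy.
    rewrite !(hs_med ms) // => H1 H2.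
    by split; split=> //; hs_tauto k.
  (* By [N], the point [z] lies in some member of [L], while [w] lies in none: that member separates
     them. The limit [k0] will then contain all of [Phi] and miss all of [J]. *)
  move=> [z w] [/= [Iz Kz] [Iw Lw]]; apply: contrapT => E; apply: N.
  exists z; split=> // k Lk kz; apply: E; exists k; split=> //; last exact: Lw.
  by case: (Ls _ Lk).
have [U [UU FU]] := ultraFilterLemma FB.
pose k0 := ulim U.
have UB z w : Phi z -> J w -> U [set k | [/\ sep x y k, k z & ~ k w]].
  by move=> Pz Jw; apply: FU; exists (z, w).
have k0Phi z : Phi z -> k0 z.
  by move=> Pz; apply: filterS (UB _ _ Pz Jx) => k [].
have k0J z : J z -> ~ k0 z.
  move=> Jz kz; have [k [[_ _ H] H']] := ulim_ex UU (UB _ _ Phiy Jz) kz; exact: H.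
have /sE[hk0 k0y k0x] : sep x y k0.
  by apply: uclosed_sep; apply: filterS (UB _ _ Phiy Jx) => k [].
(* A point of the interval outside [k0] is not in [Phi], so some member of [K] misses it. A limit of
   such members lies in [K] and, within the interval, inside [k0]. The construction of [k2] is
   dual. *)
have [k1 Kk1 k10] : exists2 k, K k & forall z, I x y z -> k z -> k0 z.
  pose D1 := [set z | I x y z /\ ~ k0 z].
  pose B1 z := [set k | K k /\ ~ k z].
  have FB1 : ProperFilter (filter_from D1 B1).
    apply: filter_from_proper.
      apply: filter_from_filter.
        by exists x; split=> //; exact: (interval_l ms hnu).
      move=> z z' [Iz nz] [Iz' nz']; exists (m y z z').
        split; last by rewrite (hs_med ms) //; tauto.
        apply: IP => h hh hx hy; rewrite (hs_med ms) //.
        by have := hsI _ _ hh Iz hx hy; tauto.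
      move=> k [Kk]; have [hk ky kx] := KE _ Kk.
      rewrite (hs_med ms) // => H.
      by split; split=> //; hs_tauto k.
    move=> z [Iz nz]; apply: contrapT => E; apply: nz; apply: k0Phi; split=> // k Kk.
    by apply: contrapT => kz; apply: E; exists k.
  have [U1 [UU1 FU1]] := ultraFilterLemma FB1.
  have UB1 z : I x y z -> ~ k0 z -> U1 [set k | K k /\ ~ k z].
    by move=> Iz nz; apply: FU1; exists z.
  exists (ulim U1).
    by apply: cK; apply: filterS (UB1 x (interval_l ms hnu _ _) k0x) => k [].
  move=> z Iz kz; apply: contrapT => nz.
  by have [k [[_ H] H']] := ulim_ex UU1 (UB1 _ Iz nz) kz; exact: H.
have [k2 Lk2 k02] : exists2 k, L k & forall z, I x y z -> k0 z -> k z.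
  pose D1 := [set z | I x y z /\ k0 z].
  pose B1 z := [set k | L k /\ k z].
  have FB1 : ProperFilter (filter_from D1 B1).
    apply: filter_from_proper.
      apply: filter_from_filter.
        by exists y; split=> //; exact: (interval_r ms hnu).
      move=> z z' [Iz nz] [Iz' nz']; exists (m x z z').
        split; last by rewrite (hs_med ms) //; tauto.
        apply: IP => h hh hx hy; rewrite (hs_med ms) //.
        by have := hsI _ _ hh Iz hx hy; tauto.
      move=> k [Lk]; have [hk ky kx] := LE _ Lk.
      rewrite (hs_med ms) // => H.
      by split; split=> //; hs_tauto k.
    move=> z [Iz nz]; apply: contrapT => E; apply: (k0J z) => //; split=> // k Kk kz.
    by apply: E; exists k.
  have [U1 [UU1 FU1]] := ultraFilterLemma FB1.
  have UB1 z : I x y z -> k0 z -> U1 [set k | L k /\ k z].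
    by move=> Iz nz; apply: FU1; exists z.
  exists (ulim U1).
    by apply: cL; apply: filterS (UB1 y (interval_r ms hnu _ _) k0y) => k [].
  by move=> z Iz kz; apply: filterS (UB1 _ Iz kz) => k [].
(* Both [k1] and [k2] contain [y] and miss [x], so they contain [u] exactly when they contain
   [m x y u]. The inclusion of [k1] in [k2] over the interval thus holds everywhere. *)
have [_ sk1] := Ks _ Kk1; have [_] := Ls _ Lk2; apply.
have [hk1 k1y k1x] := KE _ Kk1; have [hk2 k2y k2x] := LE _ Lk2.
apply: (ultra_up us sk1 hk2) => u k1u.
have Iu : I x y (m x y u) by case: (medP ms x y u).
have : k1 (m x y u) by rewrite (hs_med ms) //; tauto.
by move=> /(k10 _ Iu) /(k02 _ Iu); rewrite (hs_med ms) //; tauto.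
Qed.

(** A point separating the inner approximations [K] and [L] can only err outside their union. *)
Lemma proj_approx x y s e : ultrafilter d s -> Bsig (s `&` sep x y) -> 0 < e ->
  exists2 z, I x y z &
    (nu (symdiff (s `&` sep x y) (sep x z)) <= e%:E)%E.
Proof.
move=> us BA e0; have [K [L [[cK cL] [BK BL] Ks Ls err]]] := Bsig_regular x y BA e0.
have [||z [Iz zK zL]] := @separating_point x y s K L us cK cL.
- by move=> k /Ks[kxy []].
- by move=> k /Ls[kxy H]; split=> // sk; apply: H.
exists z => //; apply: le_trans err; have Bz : Bsig (sep x z) by exact: Bsig_sep.
have sz k : sep x z k -> sep x y k.
  move=> /sepE[hk kz kx]; apply/sepE; split=> //; apply: contrapT => ky.
  exact: (hs_interval (hsC hk) Iz kx ky).
apply: (meas_le S mo).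
- by apply: (salgU S); exact: (salgD S).
- by apply: (salgD S); [exact: Bsig_sep|exact: (salgU S)].
move=> k [[[sk kxy] nz]|[kz nk]].
  split=> // -[Kk|Lk].
    apply: nz; apply/sepE; have /sepE[hk _ kx] := kxy; split=> //; exact: zK.
  by have [_] := Ls _ Lk; apply.
split; first exact: sz.
move=> [/Ks[kxy [sk _]]|Lk]; first by apply: nk.
by have /sepE[_ + _] := kz; exact: zL.
Qed.

End Projections.

(** * Existence of projections *)

Section ProjectionExists.
Variables (R : realType) (X : Type) (d : X -> X -> R).
Variable nu : set (set X) -> \bar R.
Hypotheses (ms : median_space d) (hnu : interval_measure d nu).
Local Notation hs := (halfspace d).
Local Notation m := (med d).
Local Notation I := (interval d).
Local Notation sep := (sep d).
Local Notation Bsig := (Bsig d).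
Local Notation Bhat := (Bhat d).
Let S := Bsig_salg d.
Let mo := nu_meas hnu.

Lemma hnull_preimage (phi : set X -> set X) E :
  phi @^-1` (HS d) = HS d ->
  (forall x y, exists x' y', phi @^-1` (sep x y) = sep x' y' /\ d x' y' = d x y) ->
  (forall u v, exists u' v', sep u v = phi @^-1` (sep u' v')) ->
  hnull d nu E -> hnull d nu (phi @^-1` E).
Proof.
move=> pH ps ps' [[EH BE] nE].
have key u v : exists u' v', phi @^-1` E `&` sep u v = phi @^-1` (E `&` sep u' v').
  by have [u' [v' ->]] := ps' u v; exists u', v'.
split; first split.
- by rewrite -pH => h; exact: EH.
- by move=> u v; have [u' [v' ->]] := key u v; exact: Bsig_preimage.
- move=> u v; have [u' [v' ->]] := key u v.
  have := nu_preimage ms pH ps hnu (BE u' v') u' v'.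
  by rewrite -setIA setIid => ->.
Qed.

Lemma hnull_setC E : hnull d nu E -> hnull d nu (setC @^-1` E).
Proof.
apply: hnull_preimage; first exact: setC_HS.
  by move=> x y; exists y, x; rewrite setC_sep (dC ms).
by move=> u v; exists v, u; rewrite setC_sep.
Qed.

Lemma Bsig_Bhat E : Bsig E -> Bhat E.
Proof.
move=> BE; split; first exact: (salg_sub S).
by move=> u v; apply: (salgI S BE); exact: Bsig_sep.
Qed.

Lemma Bsig_null E : Bsig E -> nu E = 0%E -> hnull d nu E.
Proof.
move=> BE E0; split; first exact: Bsig_Bhat.
move=> u v; apply/eqP; rewrite eq_le -{1}E0.
have Bi : Bsig (E `&` sep u v) by apply: (salgI S BE); exact: Bsig_sep.
by rewrite (meas_ge0 mo Bi) andbT; apply: (meas_le S mo) => // h [].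
Qed.

(** Both ultrafilters agree on halfspaces that do not separate [x] from [y]. The hypothesis controls
    those containing [y]; those containing [x] are their complements, and complementation preserves
    null sets. *)
Lemma proj_of_null x y s l : admissible d s -> I x y l ->
  nu (symdiff (s `&` sep x y) (sep x l)) = 0%E -> proj_rel d nu x y s l.
Proof.
move=> as_ Il E0; have us := adm_ultra as_; split=> //.
pose E := symdiff (s `&` sep x y) (sep x l).
have BA : Bsig (s `&` sep x y) by case: (adm_Bhat as_).
have BE : Bsig E.
  by apply: (salgU S); apply: (salgD S) => //; exact: Bsig_sep.
have nE := Bsig_null BE E0.
apply: hnull_sub (hnullU hnu nE (hnull_setC nE)) _ _ => //.
  by apply: Bhat_symdiff; [exact: Bhat_pt|exact: Bhat_projU].
move=> h H; have hh : hs h.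
  by move: H; rewrite /symdiff /medianU /sigma_pt /=; tauto.
have hl := hs_interval hh Il.
have hlC : ~ h x -> ~ h y -> ~ h l := hs_interval (hsC hh) Il.
have sE : s (~` h) <-> ~ s h := ultraN us hh.
have xyE k : sep x y k <-> hs k /\ k y /\ ~ k x.
  by split; [move=> /sepE[]|move=> [? []] *; apply/sepE].
have xlE k : sep x l k <-> hs k /\ k l /\ ~ k x.
  by split; [move=> /sepE[]|move=> [? []] *; apply/sepE].
have hhC := hsC hh.
have EE k : E k = (((s k /\ sep x y k) /\ ~ sep x l k) \/
  (sep x l k /\ ~ (s k /\ sep x y k))) by [].
change (E h \/ E (~` h)); rewrite !EE !(propext (xyE _)) !(propext (xlE _)).
rewrite (propext sE); move: H; rewrite /symdiff /medianU /sigma_pt /setC /=.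
by case: (pselect (s h)) => ?; hs_tauto h.
Qed.

(** Halfspaces separating [z] from [m x z z'] lie in just one of [sep x z] and [sep x z'], hence in
    one of the two error sets. So [z] and [z'] are each within [2 * e] of that median. *)
Lemma approx_dist x y A z z' e : Bsig A -> I x y z -> I x y z' ->
  (nu (symdiff A (sep x z)) <= e%:E)%E ->
  (nu (symdiff A (sep x z')) <= e%:E)%E -> d z z' <= 4 * e.
Proof.
move=> BA Iz Iz' Hz Hz'.
have BD w : Bsig (symdiff A (sep x w)).
  by apply: (salgU S); apply: (salgD S) => //; exact: Bsig_sep.
have H w w' : (nu (symdiff A (sep x w)) <= e%:E)%E ->
    (nu (symdiff A (sep x w')) <= e%:E)%E -> d (m x w w') w <= e + e.
  move=> Hw Hw'; rewrite -lee_fin EFinD -(nu_sep hnu).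
  apply: le_trans (leeD Hw Hw'); apply: (meas_le_U S mo) => //.
    exact: Bsig_sep.
  move=> k /sepE[hk kw]; rewrite (hs_med ms) // => nk.
  have xw : sep x w k by apply/sepE; split=> //; tauto.
  have xw' : ~ sep x w' k by move=> /sepE[]; tauto.
  by case: (pselect (A k)) => Ak; [right; left|left; right].
have mC : m x z' z = m x z z'.
  by apply: (hs_ext ms hnu) => h hh; rewrite !(hs_med ms) //; tauto.
have := H _ _ Hz Hz'; have := H _ _ Hz' Hz; rewrite mC.
by have := dtri ms (m x z z') z z'; rewrite (dC ms z (m x z z')); lra.
Qed.

Hypothesis cpl : complete_metric d.

Lemma proj_exists x y s : admissible d s -> exists z, proj_rel d nu x y s z.
Proof.
move=> as_; have us := adm_ultra as_; pose A := s `&` sep x y.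
have BA : Bsig A by rewrite /A; case: (adm_Bhat as_).
(* With error [e / 4], [approx_dist] bounds the diameter by [e]. *)
pose T (e : R) := [set z | I x y z /\ (nu (symdiff A (sep x z)) <= (e / 4)%:E)%E].
have Tex e : 0 < e -> T e !=set0.
  move=> e0; have e4 : 0 < e / 4 by lra.
  by have [z Iz Hz] := proj_approx ms hnu us BA e4; exists z.
have [|||l Hl] := @complete_limit _ _ _ ms cpl T; first exact: Tex.
- move=> e e' e0 ee' z [Iz Hz]; split=> //; apply: le_trans Hz _.
  by rewrite lee_fin; lra.
- move=> e a b e0 [Ia Ha] [Ib Hb].
  by have := approx_dist BA Ia Ib Ha Hb; lra.
have Il : I x y l.
  suff <- : m x y l = l by case: (medP ms x y l).
  apply: (d_lt_eq ms) => e e0; have e4 : 0 < e / 4 by lra.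
  have [z [Iz Tz]] := Tex _ e4; have zl := Hl _ e4 _ (conj Iz Tz).
  have := d_med_le ms hnu x y l z; rewrite (med_id ms hnu Iz).
  by have := dtri ms z (m x y l) l; rewrite (dC ms l z); lra.
exists l; apply: proj_of_null => //.
have BD w : Bsig (symdiff A (sep x w)).
  by apply: (salgU S); apply: (salgD S) => //; exact: Bsig_sep.
apply/eqP; rewrite eq_le (meas_ge0 mo) // andbT; apply/lee_addgt0Pr => e e0.
have e4 : 0 < e / 4 by lra.
have [z [Iz Tz]] := Tex _ e4; have zl := Hl _ e4 _ (conj Iz Tz).
have lz : d l z <= e / 4 by rewrite (dC ms).
have Bs u v : Bsig (sep u v) by exact: Bsig_sep.
(* Replacing [z] by [l] only affects halfspaces separating the two, of total mass [2 * d z l]. *)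
have : (nu (symdiff A (sep x l)) <= (e / 4 / 4 + (e / 4 + e / 4))%:E)%E.
  rewrite EFinD; apply: (@le_trans _ _ (nu (symdiff A (sep x z)) +
    nu (sep z l `|` sep l z))%E).
    apply: (meas_le_U S mo) => //; first exact: (salgU S).
    move=> k H; have hk : hs k by case: H => [[[_ /sepE[]]]|[/sepE[]]].
    have E w w' : sep w w' k = (k w' /\ ~ k w).
      by apply/propext; split; [move=> /sepE[]|move=> [] *; apply/sepE].
    change (((A k /\ ~ sep x z k) \/ (sep x z k /\ ~ A k)) \/
      (sep z l k \/ sep l z k)).
    change ((A k /\ ~ sep x l k) \/ (sep x l k /\ ~ A k)) in H.
    move: H; rewrite !E => H.
    by case: (pselect (A k)) => ?; hs_tauto k.
  apply: leeD => //; apply: le_trans (meas_U S mo (Bs _ _) (Bs _ _)) _.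
  by rewrite EFinD !(nu_sep hnu); apply: leeD; rewrite lee_fin.
by move=> /le_trans; apply; rewrite add0e lee_fin; lra.
Qed.

End ProjectionExists.

(** * Limits of monotone nets *)

Section LimitPoint.
Variables (R : realType) (X : Type) (d : X -> X -> R).
Variable nu : set (set X) -> \bar R.
Hypotheses (ms : median_space d) (hnu : interval_measure d nu).
Hypothesis cpl : complete_metric d.
Local Notation hs := (halfspace d).
Local Notation m := (med d).
Local Notation I := (interval d).
Local Notation sep := (sep d).
Local Notation Bsig := (Bsig d).
Local Notation Bhat := (Bhat d).
Local Notation sg := (sigma_pt d).
Let ext := @hs_ext _ _ _ _ ms hnu.

Lemma interval_closed x y : mcl d (I x y) `<=` I x y.
Proof.
move=> l Hl; suff <- : m x y l = l by case: (medP ms x y l).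
apply: (d_lt_eq ms) => e e0; have e2 : 0 < e / 2 by lra.
have [z Iz lz] := Hl _ e2.
have := d_med_le ms hnu x y l z; rewrite (med_id ms hnu Iz).
by have := dtri ms z (m x y l) l; rewrite (dC ms z l); lra.
Qed.

Lemma interval_trans x a b c : I x b a -> I x c b -> I x c a.
Proof.
move=> ab bc; apply/(intervalP ms hnu) => h hh hx hc.
by apply: (hs_interval hh ab hx); exact: (hs_interval hh bc).
Qed.

Variables (x0 : X) (N : set X).
Hypothesis N0 : N !=set0.
(** [I x0 c a] says that [a] is between [x0] and [c]; for this order based at [x0], [N] is
    directed. *)
Hypothesis Ndir : forall a b, N a -> N b -> exists c, [/\ N c, I x0 c a & I x0 c b].

(* The points of X lying in the interval from [x0] to the limit of [N]. *)
Let Z : set X := [set w | forall e, 0 < e -> exists2 j, N j & d w (m x0 w j) < e].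

(** [d w (m x0 w j)] is the distance from [w] to the interval from [x0] to [j], which grows with
    [j]. *)
Let sdist_mono w j j' : I x0 j' j -> d w (m x0 w j') <= d w (m x0 w j).
Proof.
move=> jj'; apply: (d_sub hnu) => k /sepE[hk]; rewrite (hs_med ms) // => H kw.
apply/sepE; split=> //; rewrite (hs_med ms) //.
by have := hs_interval hk jj'; tauto.
Qed.

Let NZ : N `<=` Z.
Proof.
move=> j Nj e e0; exists j => //.
suff -> : m x0 j j = j by rewrite (dxx ms).
by apply: ext => h hh; rewrite (hs_med ms) //; tauto.
Qed.

Let Zx0 : Z x0.
Proof.
move=> e e0; have [j Nj] := N0; exists j => //.
suff -> : m x0 x0 j = x0 by rewrite (dxx ms).
by apply: ext => h hh; rewrite (hs_med ms) //; tauto.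
Qed.

Let common p q e : 0 < e -> Z p -> Z q ->
  exists2 j, N j & d p (m x0 p j) < e /\ d q (m x0 q j) < e.
Proof.
move=> e0 /(_ _ e0)[j Nj pj] /(_ _ e0)[j' Nj' qj].
have [c [Nc jc jc']] := Ndir Nj Nj'; exists c => //; split.
  exact: le_lt_trans (sdist_mono p jc) pj.
exact: le_lt_trans (sdist_mono q jc') qj.
Qed.

Let Zclosed : mcl d Z `<=` Z.
Proof.
move=> w Hw e e0; have e3 : 0 < e / 3 by lra.
have [u Zu wu] := Hw _ e3; have [j Nj uj] := Zu _ e3; exists j => //.
have := med_lip ms hnu x0 u j x0 w j; rewrite !(dxx ms) (dC ms u w).
have := dtri ms u w (m x0 w j); have := dtri ms (m x0 u j) u (m x0 w j); lra.
Qed.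

Let Zconvex : convex d Z.
Proof.
move=> p q Zp Zq w Iw e e0; have e2 : 0 < e / 2 by lra.
have [j Nj [pj qj]] := common e2 Zp Zq; exists j => //.
suff : d w (m x0 w j) <= d p (m x0 p j) + d q (m x0 q j) by lra.
apply: (d_sub2 hnu) => k /sepE[hk]; rewrite (hs_med ms) // => H kw.
have := hs_interval hk Iw; case: (pselect (k p)) => kp H1.
  by right; apply/sepE; rewrite (hs_med ms) //; split; tauto.
by left; apply/sepE; rewrite (hs_med ms) //; split; tauto.
Qed.

(** The join for the order based at [x0] is the limit of [m p q j] along [N]: once [p] and [q] are
    within [e] of the interval from [x0] to [j], later indices move this median by at most
    [2 * e]. *)
Let join p q : Z p -> Z q -> exists u, [/\ Z u, I x0 u p, I x0 u q & I p q u].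
Proof.
move=> Zp Zq.
pose P e j := [/\ N j, d p (m x0 p j) < e & d q (m x0 q j) < e].
have Pex e : 0 < e -> exists j, P e j.
  by move=> e0; have [j Nj [pj qj]] := common e0 Zp Zq; exists j.
(* Two members are compared through a common later index, at a cost of four times [e / 4]. *)
pose T e := [set m p q j | j in P (e / 4)].
have mono e j j' : P e j -> I x0 j' j -> d (m p q j) (m p q j') <= e + e.
  move=> [Nj pj qj] jj'.
  suff : d (m p q j) (m p q j') <= d (m x0 p j) p + d (m x0 q j) q.
    by rewrite (dC ms _ p) (dC ms _ q); lra.
  apply: (d_sub2 hnu) => k /sepE[hk]; rewrite !(hs_med ms) // => H1 H2.
  have := hs_interval hk jj' => H3.
  case: (pselect (k p)) => kp; [left|right]; apply/sepE; rewrite (hs_med ms) //;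
    by split=> //; hs_tauto k.
have [|||u Hu] := @complete_limit _ _ _ ms cpl T.
- move=> e e0; have e4 : 0 < e / 4 by lra.
  by have [j Pj] := Pex _ e4; exists (m p q j), j.
- move=> e e' e0 ee' _ [j [Nj pj qj] <-]; exists j => //.
  by split=> //; lra.
- move=> e _ _ e0 [j Pj <-] [j' Pj' <-].
  have [Nj _ _] := Pj; have [Nj' _ _] := Pj'.
  have [c [_ jc jc']] := Ndir Nj Nj'.
  have := mono _ _ _ Pj jc; have := mono _ _ _ Pj' jc'.
  by have := dtri ms (m p q c) (m p q j) (m p q j'); rewrite (dC ms (m p q c)); lra.
have near e : 0 < e -> exists2 j, P e j & d u (m p q j) < e.
  move=> e0; have e2 : 0 < e / 2 by lra.
  have e8 : 0 < e / 2 / 4 by lra.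
  have [j Pj] := Pex _ e8; have Tj : T (e / 2) (m p q j) by exists j.
  have := Hu _ e2 _ Tj => H; exists j; last by rewrite (dC ms); lra.
  by case: Pj => *; split=> //; lra.
have side a : (forall j e, P e j -> d a (m x0 a j) < e) -> (a = p \/ a = q) ->
    I x0 u a.
  move=> aj apq; suff <- : m x0 u a = a by case: (medP ms x0 u a).
  apply: (d_lt_eq ms) => e e0; have e2 : 0 < e / 2 by lra.
  have [j Pj uj] := near _ e2; have aje := aj _ _ Pj.
  have := med_lip ms hnu x0 u a x0 (m p q j) a; rewrite !(dxx ms).
  suff : d (m x0 (m p q j) a) a <= d (m x0 a j) a.
    have := dtri ms (m x0 (m p q j) a) (m x0 u a) a.
    by rewrite (dC ms (m x0 a j)); lra.
  apply: (d_sub hnu) => k /sepE[hk ka]; rewrite !(hs_med ms) // => H.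
  apply/sepE; split=> //; rewrite (hs_med ms) //.
  by case: apq => E; rewrite E in ka H *; hs_tauto k.
exists u; split.
- apply: Zclosed => e e0; have [j [Nj _ _] uj] := near _ e0.
  exists (m p q j) => //; apply: Zconvex Zp Zq _ _; by case: (medP ms p q j).
- by apply: side; [move=> j e []|left].
- by apply: side; [move=> j e []|right].
- apply: interval_closed => e e0; have [j _ uj] := near _ e0.
  by exists (m p q j) => //; case: (medP ms p q j).
Qed.

(** The halfspaces containing the limit, read off from [Z]: one that misses [x0] contains the limit
    when it meets [Z], one that contains [x0] when it contains [Z]. *)
Let s : set (set X) := [set k | hs k /\
  ((~ k x0 /\ exists2 w, Z w & k w) \/ (k x0 /\ Z `<=` k))].

Let s_ultra : ultrafilter d s.
Proof.
have cross p q k : hs k -> I x0 q p -> ~ k x0 -> k p -> k q.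
  move=> hk Ip kx kp; apply: contrapT => kq.
  exact: (hs_interval (hsC hk) Ip kx kq).
apply/ultraP; split.
- by move=> k [].
- move=> k1 k2 [h1 [[n1 [p Zp k1p]]|[y1 Z1]]] [h2 [[n2 [q Zq k2q]]|[y2 Z2]]].
  + have [u [Zu up uq _]] := join Zp Zq; exists u; split.
      exact: cross up n1 k1p.
    exact: cross uq n2 k2q.
  + by exists p; split=> //; exact: Z2.
  + by exists q; split=> //; exact: Z1.
  + by exists x0.
- move=> k hk; have hkC := hsC hk; case: (pselect (k x0)) => kx.
    case: (pselect (Z `<=` k)) => Zk; first by left; split=> //; right.
    right; split=> //; left; split; first by move=> /(_ kx).
    apply: contrapT => E; apply: Zk => w Zw; apply: contrapT => kw.
    by apply: E; exists w.
  case: (pselect (exists2 w, Z w & k w)) => E; first by left; split=> //; left.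
  right; split=> //; right; split=> // w Zw kw; by apply: E; exists w.
Qed.

(** On halfspaces separating [x] from [y], the limit looks like the join [u] of the gates of [x] and
    [y] in [Z]. This yields measurability of [s] and its projections. *)
Let s_local x y : exists2 u, Z u & forall k, sep x y k \/ sep y x k -> s k <-> k u.
Proof.
have Zn : Z !=set0 by exists x0.
have [p [Zp gp]] := gate_exists ms hnu cpl x Zn Zconvex Zclosed.
have [q [Zq gq]] := gate_exists ms hnu cpl y Zn Zconvex Zclosed.
have [u [Zu up uq _]] := join Zp Zq; exists u => //.
have main a b p' q' k : (forall w, Z w -> I a w p') -> (forall w, Z w -> I b w q') ->
    I x0 u p' -> I x0 u q' -> sep a b k -> s k <-> k u.
  move=> ga gb up' uq' /sepE[hk kb ka]; split.
    move=> [_ [[kx [w Zw kw]]|[_]]]; last exact.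
    have kq : k q' by exact: (hs_interval hk (gb _ Zw)).
    by apply: contrapT => ku; exact: (hs_interval (hsC hk) uq' kx ku).
  move=> ku; split=> //; case: (pselect (k x0)) => kx; last first.
    by left; split=> //; exists u.
  right; split=> // w Zw; apply: contrapT => kw.
  apply: (hs_interval (hsC hk) (ga _ Zw) ka kw).
  exact: (hs_interval hk up').
by move=> k [|]; [exact: main gp gq up uq|exact: main gq gp uq up].
Qed.

Let s_adm : admissible d s.
Proof.
apply: (adm_intro x0); first exact: s_ultra.
split; first by move=> k [].
move=> x y; have [u Zu su] := s_local x y.
rewrite (_ : _ `&` _ = sep x y `&` sep x u).
  by apply: (salgI (Bsig_salg d)); exact: Bsig_sep.
apply/seteqP; split=> k.
  move=> [sk kxy]; split=> //; have /sepE[hk _ kx] := kxy.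
  by apply/sepE; split=> //; apply/su => //; left.
move=> [kxy /sepE[_ ku _]]; split=> //; apply/su => //; by left.
Qed.

Lemma limit_point : exists s, admissible d s /\ forall x y, exists2 z,
  proj_rel d nu x y s z & forall e, 0 < e -> exists2 j0, N j0 &
    forall j, N j -> I x0 j j0 -> d z (m x y j) < e.
Proof.
exists s; split; first exact: s_adm.
move=> x y; have [u Zu su] := s_local x y; exists (m x y u).
  apply: (proj_exact hnu); first by case: (medP ms x y u).
  rewrite (sigma_med ms); apply/seteqP; split=> k; rewrite /medianU /sigma_pt /=.
    move=> H; have hk : hs k by tauto.
    have := su k; rewrite !(propext (sepE _ _ _ _)) => su'.
    have [[kx ky]|[[kx ky]|[kx ky]]] :
      (k x /\ k y) \/ (k y /\ ~ k x) \/ (k x /\ ~ k y) by hs_tauto k.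
    + by tauto.
    + have : s k <-> k u by apply: su'; left.
      by tauto.
    + have : s k <-> k u by apply: su'; right.
      by tauto.
  move=> H; have hk : hs k by case: H => [[[[]]|[[]]]|[_ []]].
  have := su k; rewrite !(propext (sepE _ _ _ _)) => su'.
  have [[kx ky]|[[kx ky]|[[kx ky]|[kx ky]]]] :
    (k x /\ k y) \/ (k y /\ ~ k x) \/ (k x /\ ~ k y) \/ (~ k x /\ ~ k y).
    by hs_tauto k.
  + by tauto.
  + have : s k <-> k u by apply: su'; left.
    by tauto.
  + have : s k <-> k u by apply: su'; right.
    by tauto.
  + by tauto.
move=> e /Zu[j0 Nj0 uj]; exists j0 => // j Nj jj0.
apply: le_lt_trans uj; apply: (d_sub hnu) => k /sepE[hk].
rewrite !(hs_med ms) // => H1 H2.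
have sku : s k <-> k u.
  apply: su; have [[ky kx]|[kx ky]] : (k y /\ ~ k x) \/ (k x /\ ~ k y) by hs_tauto k.
    by left; apply/sepE.
  by right; apply/sepE.
have ku : ~ k u by hs_tauto k.
have kj : k j by hs_tauto k.
(* Otherwise [j], a point of [Z], would put [k] in [s], hence [u] in [k]. With [x0] and [j] in [k],
   the point [j0] between them is in [k] as well. *)
have kx0 : k x0.
  apply: contrapT => kx; apply: ku; apply/sku; split=> //; left; split=> //.
  by exists j => //; exact: NZ.
apply/sepE; split=> //; rewrite (hs_med ms) //.
by have := hs_interval hk jj0 kx0 kj; tauto.
Qed.

(** The limit is chosen before [B] and [C], so that a single point can serve for the closures of all
    translates. *)
Lemma limit_rclosure : exists2 s, admissible d s &
  forall (B : set X) (C : set (set (set X))),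
  (forall j0 e, N j0 -> 0 < e ->
     exists j b, [/\ N j, I x0 j j0, B b & d j b < e]) ->
  (forall b, B b -> C (sg b)) -> rclosure d nu C s.
Proof.
have [t [at_ Ht]] := limit_point; exists t => // B C NB BC; split=> // n pts e e0.
have e2 : 0 < e / 2 by lra.
have [j0 Nj0 H0] : exists2 j0, N j0 & forall i, (i < n)%N -> exists2 w,
    proj_rel d nu (pts i).1 (pts i).2 t w &
    forall j, N j -> I x0 j j0 -> d w (m (pts i).1 (pts i).2 j) < e / 2.
  elim: n => [|n [j1 Nj1 IH]]; first by have [j Nj] := N0; exists j.
  have [w pw Hw] := Ht (pts n).1 (pts n).2; have [j2 Nj2 H2] := Hw _ e2.
  have [c [Nc c1 c2]] := Ndir Nj1 Nj2; exists c => // i.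
  rewrite ltnS leq_eqVlt => /orP[/eqP ->|/IH[w' pw' Hw']].
    by exists w => // j Nj cj; apply: H2 => //; exact: interval_trans c2 cj.
  by exists w' => // j Nj cj; apply: Hw' => //; exact: interval_trans c1 cj.
have [j [b [Nj jj0 Bb jb]]] := NB _ _ Nj0 e2.
exists (sg b); split; [exact: adm_pt|exact: BC|].
move=> i /H0[w pw Hw]; exists (m (pts i).1 (pts i).2 b), w; split=> //.
  exact: proj_pt.
have := Hw _ Nj jj0; have := d_med_le ms hnu (pts i).1 (pts i).2 b j.
have := dtri ms (m (pts i).1 (pts i).2 j) (m (pts i).1 (pts i).2 b) w.
by rewrite (dC ms (m (pts i).1 (pts i).2 j) w) (dC ms b j); lra.
Qed.

End LimitPoint.

(** * Closures and the group action *)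

Section Closure.
Variables (R : realType) (X : Type) (d : X -> X -> R).
Variable nu : set (set X) -> \bar R.
Hypotheses (ms : median_space d) (hnu : interval_measure d nu).
Local Notation hs := (halfspace d).
Local Notation m := (med d).
Local Notation sep := (sep d).
Local Notation sg := (sigma_pt d).
Local Notation adm := (admissible d).
Local Notation proj := (proj_rel d nu).
Local Notation rcl := (rclosure d nu).
Local Notation hstar := (htilde_star d).

Lemma proj_sym x y s z : proj x y s z -> proj y x s z.
Proof.
move=> [Iz pz]; split.
  by move: Iz; rewrite /interval /= addrC (dC ms z x) (dC ms y z) (dC ms y x).
rewrite (_ : medianU _ _ _ = medianU (sg x) (sg y) s) //.
by apply/seteqP; split=> k; rewrite /medianU /=; tauto.
Qed.

Lemma rclosure_trans (A B : set (set (set X))) : A `<=` rcl B -> rcl A `<=` rcl B.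
Proof.
move=> AB p [ap Hp]; split=> // n pts e e0; have e2 : 0 < e / 2 by lra.
have [a [aa Aa Ha]] := Hp n pts _ e2.
have [_ /(_ n pts _ e2)[b [ab Bb Hb]]] := AB _ Aa.
exists b; split=> // i lt; have [z [w [pz pw zw]]] := Ha _ lt.
have [z' [w' [pz' pw' zw']]] := Hb _ lt; exists z', w; split=> //.
rewrite (proj_unique ms hnu aa pw' pz) in zw'.
by have := dtri ms z z' w; lra.
Qed.

Lemma rclosure_xequiv A s t : adm t -> xequiv d nu s t -> rcl A s -> rcl A t.
Proof.
move=> at_ st [as_ Hs]; split=> // n pts e e0.
have [a [aa Aa Ha]] := Hs n pts _ e0; exists a; split=> // i /Ha[z [w [pz pw zw]]].
by exists z, w; split=> //; exact: (proj_xequiv hnu as_ at_ st).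
Qed.

(** Projections are continuous, so one that is constant on [A] is constant on its closure. *)
Lemma rclosure_fixed (A : set (set (set X))) x y z s :
  (forall a, A a -> adm a -> proj x y a z) -> rcl A s -> proj x y s z.
Proof.
move=> HA [as_ Hs].
have H e : 0 < e -> exists2 w, proj x y s w & d z w < e.
  move=> e0; have [a [aa Aa /(_ 0%N isT)]] := Hs 1%N (fun=> (x, y)) _ e0.
  move=> [z' [w [pz pw zw]]]; exists w => //.
  by rewrite (proj_unique ms hnu aa (HA _ Aa aa) pz).
have [w pw _] := H 1 ltr01; suff -> : z = w by [].
apply: (d_lt_eq ms) => e /H[w' pw' zw'].
by rewrite (proj_unique ms hnu as_ pw pw').
Qed.

(** An ultrafilter without [h] contains the complement of [h], hence all halfspaces including it,
    among them those with [p] and without [q]. Its median with [p] and [q] is therefore [p]. *)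
Lemma hstar_proj h p q a : hs h ->
  (forall k, hs k -> k p -> ~ k q -> ~` h `<=` k) -> hstar h a -> proj p q a p.
Proof.
move=> hh H [aa ah]; have ua := adm_ultra aa.
have ahC : a (~` h) by apply/(ultraN ua hh).
apply: (proj_exact hnu); first exact: (interval_l ms hnu).
have in_a k : hs k -> k p -> ~ k q -> a k.
  by move=> hk kp kq; exact: (ultra_up ua ahC hk (H _ hk kp kq)).
apply/seteqP; split=> k; rewrite /medianU /sigma_pt /=.
  by move=> [hk kp]; have := in_a _ hk kp; case: (pselect (k q)); tauto.
move=> [[[[hk kp] _]|[[hk kq] ak]]|[_ [hk kp]]] //.
split=> //; apply: contrapT => kp.
have : a (~` k) by apply: in_a => //; exact: hsC.
by move=> /(ultraN ua hk); apply.
Qed.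

Hypothesis cpl : complete_metric d.

(** Projections commute with medians, and medians are Lipschitz. The fixed argument [c] must be
    projected too, which requires [proj_exists]. *)
Lemma rclosure_medianU (A : set (set (set X))) a b c :
  (forall a' b', A a' -> A b' -> A (medianU a' b' c)) ->
  rcl A a -> rcl A b -> adm c -> rcl A (medianU a b c).
Proof.
move=> HA [aa Ha] [ab Hb] ac; split; first exact: adm_medianU.
move=> n pts e e0; have e2 : 0 < e / 2 by lra.
have [a' [aa' Aa' Ha']] := Ha n pts _ e2; have [b' [ab' Ab' Hb']] := Hb n pts _ e2.
exists (medianU a' b' c); split; [exact: adm_medianU|exact: HA|].
move=> i lt; have [z1 [w1 [pz1 pw1 d1]]] := Ha' _ lt.
have [z2 [w2 [pz2 pw2 d2]]] := Hb' _ lt.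
have [z3 pz3] := proj_exists ms hnu cpl (pts i).1 (pts i).2 ac.
exists (m z1 z2 z3), (m w1 w2 z3); split; try exact: proj_medianU.
by have := med_lip ms hnu z1 z2 z3 w1 w2 z3; rewrite (dxx ms); lra.
Qed.

End Closure.

(** * The group action on halfspaces and on the compactification *)

Section Action.
Variables (R : realType) (X : Type) (d : X -> X -> R).
Variable nu : set (set X) -> \bar R.
Hypotheses (ms : median_space d) (hnu : interval_measure d nu).
Variables (G : Type) (mul : G -> G -> G) (one : G) (inv : G -> G).
Variable act : G -> X -> X.
Hypothesis isom : isometric_action d mul one inv act.
Local Notation hs := (halfspace d).
Local Notation I := (interval d).
Local Notation sep := (sep d).
Local Notation sg := (sigma_pt d).
Local Notation adm := (admissible d).
Local Notation proj := (proj_rel d nu).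
Local Notation rcl := (rclosure d nu).
Local Notation hstar := (htilde_star d).
Local Notation actU := (actU act).

Lemma act1 x : act one x = x. Proof. by case: isom. Qed.
Lemma actM g k x : act (mul g k) x = act g (act k x). Proof. by case: isom. Qed.
Lemma act_isom g x y : d (act g x) (act g y) = d x y. Proof. by case: isom. Qed.

Lemma actK g x : act (inv g) (act g x) = x.
Proof. by rewrite -actM; case: isom => -[_ _ H] _ _ _; rewrite (H g).1 act1. Qed.

Lemma actVK g x : act g (act (inv g) x) = x.
Proof. by rewrite -actM; case: isom => -[_ _ H] _ _ _; rewrite (H g).2 act1. Qed.

Lemma act_image g (A : set X) : act g @` A = act (inv g) @^-1` A.
Proof.
apply/seteqP; split=> x /=; first by move=> [y Ay <-]; rewrite actK.
by move=> H; exists (act (inv g) x) => //; rewrite actVK.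
Qed.

Lemma act_imageK g (A : set X) : act (inv g) @` (act g @` A) = A.
Proof.
by rewrite -[RHS]image_id image_comp; apply: eq_imagel => x _ /=; rewrite actK.
Qed.

Lemma act_imageVK g (A : set X) : act g @` (act (inv g) @` A) = A.
Proof.
by rewrite -[RHS]image_id image_comp; apply: eq_imagel => x _ /=; rewrite actVK.
Qed.

Lemma act_imageC g (A : set X) : act g @` (~` A) = ~` (act g @` A).
Proof. by rewrite !act_image. Qed.

Lemma interval_act g x y z : I (act g x) (act g y) (act g z) <-> I x y z.
Proof. by rewrite /interval /= !act_isom. Qed.

Lemma convex_act g A : convex d A -> convex d (act g @` A).
Proof.
move=> cA _ _ [x Ax <-] [y Ay <-] z Iz; exists (act (inv g) z); last exact: actVK.
by apply: (cA x y) => //; apply/(interval_act g); rewrite actVK.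
Qed.

Lemma hs_act g h : hs h -> hs (act g @` h).
Proof.
move=> [[x hx] hT ch cC]; split.
- by exists (act g x), x.
- by move=> E; apply: hT; rewrite -(act_imageK g h) E; apply/seteqP; split=> // x' _;
    exists (act g x') => //; exact: actK.
- exact: convex_act.
- by rewrite -act_imageC; exact: convex_act.
Qed.

Lemma hs_actE g h : hs (act g @` h) <-> hs h.
Proof.
by split=> [/(hs_act (inv g))|]; [rewrite act_imageK|exact: hs_act].
Qed.

Lemma sep_actE g x y k : sep x y (act g @` k) <-> sep (act (inv g) x) (act (inv g) y) k.
Proof.
have E x' : (act g @` k) x' = k (act (inv g) x') by rewrite act_image.
split=> /sepE[hk ky kx]; apply/sepE; rewrite ?E in ky kx *; split=> //.
  exact/(hs_actE g).
exact/hs_actE.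
Qed.

Lemma actUE g (s : set (set X)) k : actU g s k = s (act (inv g) @` k).
Proof.
apply/propext; split=> [[h sh <-]|sk]; first by rewrite act_imageK.
by exists (act (inv g) @` k) => //; rewrite act_imageVK.
Qed.

Lemma actU_preimage g (s : set (set X)) :
  actU g s = (fun k => act (inv g) @` k) @^-1` s.
Proof. by apply/funext => k; rewrite actUE. Qed.

Lemma actU1 s : actU one s = s.
Proof.
rewrite /Defs.actU -[RHS]image_id; apply: eq_imagel => h _ /=.
by rewrite -[RHS]image_id; apply: eq_imagel => x _ /=; exact: act1.
Qed.

Lemma actUM g k s : actU (mul g k) s = actU g (actU k s).
Proof.
rewrite /Defs.actU image_comp; apply: eq_imagel => h _ /=.
by rewrite image_comp; apply: eq_imagel => x _ /=; exact: actM.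
Qed.

Lemma actUVK g s : actU g (actU (inv g) s) = s.
Proof. by rewrite -actUM; case: isom => -[_ _ H] _ _ _; rewrite (H g).2 actU1. Qed.

Lemma actU_pt g x : actU g (sg x) = sg (act g x).
Proof.
apply/seteqP; split=> k; rewrite actUE.
  by move=> [/hs_actE hk [y ky <-]]; rewrite /sigma_pt /= actVK.
by move=> [hk kx]; split; [exact: hs_act|exists (act g x) => //; exact: actK].
Qed.

Lemma actU_medianU g a b c :
  actU g (medianU a b c) = medianU (actU g a) (actU g b) (actU g c).
Proof. by rewrite !actU_preimage. Qed.

Lemma actU_symdiff g a b : actU g (symdiff a b) = symdiff (actU g a) (actU g b).
Proof. by rewrite !actU_preimage. Qed.

Let pre g := fun k : set X => act (inv g) @` k.

Let pre_HS g : pre g @^-1` (HS d) = HS d.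
Proof. by apply/seteqP; split=> k H; exact/(hs_actE (inv g)). Qed.

Let pre_sep g x y : pre g @^-1` (sep x y) =
  sep (act (inv (inv g)) x) (act (inv (inv g)) y).
Proof. by apply/seteqP; split=> k H; exact/(sep_actE (inv g)). Qed.

Let pre_sep1 g x y : exists x' y', pre g @^-1` (sep x y) = sep x' y' /\ d x' y' = d x y.
Proof.
by exists (act (inv (inv g)) x), (act (inv (inv g)) y); rewrite pre_sep act_isom.
Qed.

Let pre_sep2 g u v : exists u' v', sep u v = pre g @^-1` (sep u' v').
Proof. by exists (act (inv g) u), (act (inv g) v); rewrite pre_sep !actK. Qed.

Lemma hnull_act g E : hnull d nu E -> hnull d nu (actU g E).
Proof.
rewrite actU_preimage.
exact: (hnull_preimage ms hnu (pre_HS g) (pre_sep1 g) (pre_sep2 g)).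
Qed.

Lemma xequiv_act g s t : xequiv d nu s t -> xequiv d nu (actU g s) (actU g t).
Proof. by rewrite /xequiv -actU_symdiff; exact: hnull_act. Qed.

Lemma Bhat_act g E : Bhat d E -> Bhat d (actU g E).
Proof.
move=> [EH BE]; rewrite actU_preimage; split.
  by rewrite -(pre_HS g) => k; exact: EH.
move=> u v; have [u' [v' ->]] := pre_sep2 g u v.
by rewrite -preimage_setI; exact: (Bsig_preimage (pre_HS g) (pre_sep1 g)).
Qed.

Lemma adm_act g s : adm s -> adm (actU g s).
Proof.
move=> as_; have [_ [x _]] := as_; apply: (adm_intro x); last exact/Bhat_act/adm_Bhat.
have /ultraP[sH sm sc] := adm_ultra as_; apply/ultraP; split.
- by move=> k; rewrite actUE => /sH /hs_actE.
- move=> h k; rewrite !actUE => sh sk; have [y] := sm _ _ sh sk.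
  by rewrite !act_image => -[hy ky]; exists (act (inv (inv g)) y).
- by move=> h hh; rewrite !actUE act_imageC; apply: sc; exact: hs_act.
Qed.

Lemma proj_act g x y s z : proj x y s z ->
  proj (act g x) (act g y) (actU g s) (act g z).
Proof.
move=> [Iz pz]; split; first exact/interval_act.
by rewrite -!actU_pt -actU_medianU; exact: xequiv_act.
Qed.

Lemma rclosure_act g (A B : set (set (set X))) p :
  (forall a, A a -> B (actU g a)) -> rcl A p -> rcl B (actU g p).
Proof.
move=> AB [ap Hp]; split; first exact: adm_act.
move=> n pts e e0.
have [a [aa Aa Ha]] :=
  Hp n (fun i => (act (inv g) (pts i).1, act (inv g) (pts i).2)) _ e0.
exists (actU g a); split; [exact: adm_act|exact: AB|].
move=> i /Ha[z [w [/(proj_act g) + /(proj_act g) + zw]]] /=; rewrite !actVK => pz pw.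
by exists (act g z), (act g w); split=> //; rewrite act_isom.
Qed.

Lemma hstar_act g h a : hstar h a -> hstar (act g @` h) (actU g a).
Proof.
by move=> [aa ah]; split; [exact: adm_act|rewrite actUE act_imageK].
Qed.

End Action.

(** * Flipping *)

Section Flipping.
Variables (R : realType) (X : Type) (d : X -> X -> R).
Variable nu : set (set X) -> \bar R.
Hypotheses (ms : median_space d) (hnu : interval_measure d nu).
Hypothesis cpl : complete_metric d.
Variables (G : Type) (mul : G -> G -> G) (one : G) (inv : G -> G).
Variable act : G -> X -> X.
Hypothesis isom : isometric_action d mul one inv act.
Local Notation hs := (halfspace d).
Local Notation m := (med d).
Local Notation I := (interval d).
Local Notation sg := (sigma_pt d).
Local Notation rcl := (rclosure d nu).
Local Notation hstar := (htilde_star d).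

Lemma hs_ne0 h : hs h -> h !=set0. Proof. by case. Qed.
Lemma hs_convex h : hs h -> convex d h. Proof. by case. Qed.

Lemma mcl_ne0 (D : set X) : D !=set0 -> mcl d D !=set0.
Proof. by move=> [x Dx]; exists x; exact: mclW. Qed.

Lemma flips_not_alternative2 g h : hs h -> flips d act g h ->
  ~ alternative2 d act nu h.
Proof.
move=> hh [dist0 _] [C [_ [s Cs] _ [_ _ Cinv Csub]]].
have hC := hsC hh; have hgC := hs_act isom g hC.
have [p [q [Dp Eq Hp Hq]]] := bigate ms hnu cpl
  (mcl_ne0 (hs_ne0 hC)) (mcl_convex ms hnu (hs_convex hC)) (@mclK _ _ _ ms _)
  (mcl_ne0 (hs_ne0 hgC)) (mcl_convex ms hnu (hs_convex hgC)) (@mclK _ _ _ ms _).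
have psp : proj_rel d nu p q s p.
  apply: (rclosure_fixed ms hnu) _ (Csub _ Cs) => a ha _.
  apply: (hstar_proj ms hnu hh) _ ha => k hk kp kq.
  by move=> y hy; exact: (Hp k hk kp kq y (mclW ms hy)).
have psq : proj_rel d nu p q s q.
  (* By invariance the translate of [s] by [inv g] is in the closure for [h]; translating back by
     [g] puts [s] in the closure for [g h]. *)
  have Ct : rcl (hstar h) (actU act (inv g) s) by apply: Csub; exact: Cinv.
  have Cgs : rcl (hstar (act g @` h)) s.
    rewrite -(actUVK isom g s); apply: (rclosure_act ms hnu isom) _ Ct => a.
    exact: (hstar_act isom).
  apply: proj_sym => //; apply: (rclosure_fixed ms hnu) _ Cgs => a ha _.
  apply: (hstar_proj ms hnu (hs_act isom g hh)) _ ha => k hk kq kp.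
  rewrite -(act_imageC isom).
  by move=> y hy; exact: (Hq k hk kq kp y (mclW ms hy)).
have as_ : admissible d s by case: (Csub _ Cs).
have pq : p = q by exact: (proj_unique ms hnu as_ psp psq).
(* The common point [p = q] is in both metric closures, so points of the two sides within [r / 2] of
   it are less than [r] apart. *)
set r := set_dist _ _ _ in dist0; have r2 : 0 < r / 2 by lra.
have [u hu pu] := Dp _ r2; have [v gv qv] := Eq _ r2.
suff : r <= d v u by have := dtri ms p v u; rewrite (dC ms v p) -pq in qv *; lra.
apply: ge_inf; last by exists v, u.
by exists 0 => _ [a [b [_ _ ->]]]; exact: d_ge0.
Qed.

(** No wall inversion at the complement of [h] gives the second clause of [flips], so not flipping
    means distance zero. Two translates reduce to one by [inv l]. *)
Lemma not_flippable_close h : no_wall_inversions d act -> hs h ->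
  ~ flippable d act h -> forall g l e, 0 < e -> exists u v,
  [/\ (act g @` (~` h)) u, (act l @` (~` h)) v & d u v < e].
Proof.
move=> nwi hh nf g l e e0; have hC := hsC hh.
pose k := mul (inv l) g.
have ak x : act l (act k x) = act g x.
  by rewrite /k (actM isom) (actVK isom).
have : ~ 0 < set_dist d (act k @` (~` h)) (~` h).
  move=> dist0; apply: nf; exists k; split=> // E.
  by apply: (nwi k _ hC); rewrite setCK.
set E := set_dist _ _ _ => /negP; rewrite -leNgt => E0.
have [x hx] := hs_ne0 hC.
have hE : has_inf [set r | exists a b, [/\ (act k @` (~` h)) a, (~` h) b & r = d a b]].
  split; first by exists (d (act k x) x), (act k x), x; split=> //; exists x.
  by exists 0 => _ [a [b [_ _ ->]]]; exact: d_ge0.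
have [_ [a [b [[a' ha <-] hb ->]]] lt] := inf_adherent e0 hE.
exists (act g a'), (act l b); split; [by exists a'|by exists b|].
by rewrite -ak (act_isom isom); apply: lt_le_trans lt _; rewrite -/E; lra.
Qed.

Lemma common_point h : no_wall_inversions d act -> hs h ->
  ~ flippable d act h ->
  exists2 t, admissible d t & forall g, rcl (hstar (act g @` h)) t.
Proof.
move=> nwi hh nf; have hC := hsC hh.
pose K g := mcl d (act g @` (~` h)).
have K0 g : K g !=set0 by apply: mcl_ne0; exact: (hs_ne0 (hs_act isom g hC)).
have cK g : convex d (K g).
  by apply: (mcl_convex ms hnu); exact: (hs_convex (hs_act isom g hC)).
have clK g : mcl d (K g) `<=` K g by exact: mclK.
have KK g l : (K g `&` K l) !=set0.
  apply: (dist0_meet ms hnu cpl) => // e e0.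
  have [u [v [gu lv uv]]] := not_flippable_close nwi hh nf g l e0.
  by exists u, v; split=> //; exact: mclW.
(* Finite intersections are indexed by lists of group elements; concatenating lists makes the gates
   of [x0] a directed family. *)
pose KF F := foldr (fun j D => K j `&` D) setT F.
have KF0 F : KF F !=set0.
  by have [x [_ Fx]] := helly ms hnu F cK KK one one; exists x.
have cKF F : convex d (KF F).
  by elim: F => [|a F IH] //= x y [ax Fx] [ay Fy] z Iz; split; [exact: cK Iz|exact: IH Iz].
have clKF F : mcl d (KF F) `<=` KF F.
  elim: F => [|a F IH] //= x Hx; split.
    by apply: clK => e /Hx[u [au _] xu]; exists u.
  by apply: IH => e /Hx[u [_ Fu] xu]; exists u.
have [x0 _] := hs_ne0 hh.
pose N := [set p | exists F, is_gate d (KF F) x0 p].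
have gN F : exists p, is_gate d (KF F) x0 p by exact: (gate_exists ms hnu cpl).
have KFcat F1 F2 : KF (F1 ++ F2) `<=` KF F1 `&` KF F2.
  by elim: F1 => [|a F1 IH] //= x [ax /IH[]].
have N0 : N !=set0 by have [p gp] := gN [::]; exists p, [::].
have Ndir a b : N a -> N b -> exists c, [/\ N c, I x0 c a & I x0 c b].
  move=> [F1 [_ g1]] [F2 [_ g2]]; have [c gc] := gN (F1 ++ F2).
  have [Fc _] := gc; have [c1 c2] := KFcat _ _ _ Fc.
  by exists c; split; [exists (F1 ++ F2)|exact: g1|exact: g2].
have [t at_ Ht] := limit_rclosure ms hnu cpl N0 Ndir.
exists t => // g; apply: (Ht (act g @` (~` h))).
  (* Adding [g] to the list moves to a later gate that lies in [K g], hence near the translate by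
     [g] of the complement of [h]. *)
  move=> j0 e [F [_ gF]] e0; have [j gj] := gN (g :: F).
  have [[gKj Fj] _] := gj; have [b hb jb] := gKj _ e0.
  by exists j, b; split=> //; [exists (g :: F)|exact: gF].
move=> b; rewrite (act_imageC isom) => hb; split; first exact: adm_pt.
by move=> [_ /hb].
Qed.

Lemma not_flippable_alternative2 h : no_wall_inversions d act -> thick d h ->
  ~ flippable d act h -> alternative2 d act nu h.
Proof.
move=> nwi [hh [x [r [r0 xr]]] _] nf; have hC := hsC hh.
have [t at_ Ht] := common_point nwi hh nf.
(* The largest invariant part of the closure: all points whose whole orbit stays in it. *)
exists [set s | admissible d s /\ forall g, rcl (hstar h) (actU act g s)].
split.
- split; first by move=> s [].
  move=> s u au su [as_ Hs]; split=> // g.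
  apply: (rclosure_xequiv hnu) (Hs g); first exact: (adm_act isom).
  exact: (xequiv_act ms hnu isom).
- exists t; split=> // g.
  apply: (rclosure_act ms hnu isom) _ (Ht (inv g)) => a.
  by move=> /(hstar_act isom g); rewrite (act_imageVK isom).
(* An interior point [x] of [h] is left out: otherwise it would equal its gate [p] in the metric
   closure of the complement of [h], against the ball around [x] inside [h]. *)
- exists (sg x); split; first exact: adm_pt.
  move=> [_ /(_ one)]; rewrite (actU1 isom) => Hx.
  have x1 : [set x] !=set0 by exists x.
  have cx : convex d [set x].
    move=> _ _ -> -> z; rewrite /interval /= (dxx ms) (dC ms z x) => E.
    by apply: (d_eq0 ms); rewrite (dC ms); lra.
  have clx : mcl d [set x] `<=` [set x].
    by move=> z Hz; apply: (d_lt_eq ms) => e /Hz[_ ->].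
  have [p [q [Dp -> Hp _]]] := bigate ms hnu cpl
    (mcl_ne0 (hs_ne0 hC)) (mcl_convex ms hnu (hs_convex hC)) (@mclK _ _ _ ms _)
    x1 cx clx.
  have pp : proj_rel d nu p x (sg x) p.
    apply: (rclosure_fixed ms hnu) _ Hx => a ha _.
    apply: (hstar_proj ms hnu hh) _ ha => k hk kp kq.
    by move=> y hy; exact: (Hp k hk kp kq y (mclW ms hy)).
  have px := proj_unique ms hnu (adm_pt d x) pp (proj_pt ms hnu p x x).
  have mx : m p x x = x.
    by apply: (hs_ext ms hnu) => k hk; rewrite (hs_med ms) //; tauto.
  rewrite mx in px; rewrite px in Dp.
  by have [u hu xu] := Dp _ r0; apply: hu; exact: xr.
- split.
  + move=> s Hs; have [as_ _] := Hs; split=> // g.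
    apply: (@rclosure_trans _ _ _ _ ms hnu
      [set actU act g a | a in [set s | admissible d s /\
        forall g, rcl (hstar h) (actU act g s)]]).
      by move=> _ [a [_ Ha] <-].
    by apply: (rclosure_act ms hnu isom) _ Hs => a Ca; exists a.
  (* Two ultrafilters without [h] outvote any third one, so the star side absorbs medians with [c];
     this passes to the closure. *)
  + move=> a b c [aa Ha] [ab Hb] ac; split; first exact: adm_medianU.
    move=> g; rewrite (actU_medianU isom).
    apply: (rclosure_medianU ms hnu cpl) => //; last exact: (adm_act isom).
    move=> a' b' [aa' na'] [ab' nb']; split.
      by apply: adm_medianU => //; exact: (adm_act isom).
    by rewrite /medianU /=; tauto.
  + move=> g s [as_ Hs]; split; first exact: (adm_act isom).
    by move=> l; rewrite -(actUM isom).
  + by move=> s [_ /(_ one)]; rewrite (actU1 isom).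
Qed.

End Flipping.

(** That exactly one alternative holds is expressed as equivalence of the first with the negation of
    the second. The measure is a parameter, determined inside separating sets by
    [interval_measure_unique]. *)
Theorem theorem5p1 (R : realType) (X : Type) (d : X -> X -> R)
  (G : Type) (mul : G -> G -> G) (one : G) (inv : G -> G) (act : G -> X -> X)
  (nu : set (set X) -> \bar R) :
  median_space d -> complete_metric d -> finite_rank d ->
  isometric_action d mul one inv act ->
  no_wall_inversions d act ->
  interval_measure d nu ->
  forall h : set X, thick d h ->
    (flippable d act h <-> ~ alternative2 d act nu h).
Proof.
move=> ms cpl _ isom nwi hnu h th; split.
  by have [hh _ _] := th; move=> [g]; exact: (flips_not_alternative2 ms hnu cpl isom hh).
move=> na; apply: contrapT => nf; apply: na.
exact: (not_flippable_alternative2 ms hnu cpl isom nwi th nf).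
Qed.
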